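(* Let $Q$ be a strongly locally finite quiver and $k$ a field. Then the following are equivalent: (1) $Q$ has no right infinite paths. (2) $rep^+(Q)$ is left Auslander-Reiten. (3) Any morphism $f:X\rightarrow Y$ in $rep^+(Q)$ has a unique minimal right determiner.
   Context: A quiver $Q=(Q_0,Q_1)$ is locally finite if each vertex is the start or end of only finitely many arrows, interval finite if for all $x,y\in Q_0$ there are only finitely many paths from $x$ to $y$, and strongly locally finite if both hold. A right infinite path is an infinite path $\circ\to\circ\to\circ\to\cdots$. $rep(Q)$ is the category of locally finite dimensional $k$-representations of $Q$ (covariant: $M(\alpha):M(x)\to M(y)$ for $\alpha:x\to y$, each $M(x)$ finite dimensional). For $x\in Q_0$, $P_x$ is the indecomposable projective representation at $x$ ($P_x(y)$ has as basis the paths from $x$ to $y$), and $proj(Q)$ is the additive subcategory of $rep(Q)$ generated by the $P_x$, $x\in Q_0$. $M\in rep(Q)$ is finitely presented if there is an exact sequence $0\to P_1\to P_0\to M\to 0$ with $P_0,P_1\in proj(Q)$; $rep^+(Q)$ is the full subcategory of finitely presented representations (it is $\operatorname{Hom}$-finite, hereditary and abelian). In an abelian category $\mathcal C$: a morphism $g:A\to B$ is left almost split if it is not a split monomorphism and every morphism $A\to Z$ that is not a split monomorphism factors through $g$; it is left minimal if $hg=g$ implies $h$ is an automorphism; minimal left almost split means both. Right almost split is defined dually. An almost split sequence is an exact sequence $0\to A\xrightarrow{s}B\xrightarrow{t}C\to0$ with $s$ left almost split and $t$ right almost split; $A$ is its starting term. $\mathcal C$ is left Auslander-Reiten if every indecomposable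 object is the starting term of a minimal left almost split epimorphism or the starting term of an almost split sequence. Subcategories $\mathcal D\subseteq\mathcal C$ are always full and closed under (finite) direct sums and direct summands. $f:X\to Y$ is right determined by $\mathcal D$ (and $\mathcal D$ is a right determiner of $f$) if for every $f':X'\to Y$ the following are equivalent: (a) $f'$ factors through $f$; (b) for every $Z\in\mathcal D$ and $g:Z\to X'$, $f'g$ factors through $f$. $\mathcal D$ is a minimal right determiner of $f$ if it is a right determiner and no $\mathcal D'\subsetneq\mathcal D$ is one; it is unique if it equals every minimal right determiner of $f$. *)

(* Defs.v *)
From HB Require Import structures.
From mathcomp Require Import all_boot all_order all_algebra finmap.
From mathcomp Require Import boolp classical_sets functions cardinality.

Set Implicit Arguments.
Unset Strict Implicit.
Unset Printing Implicit Defensive.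
Import GRing.Theory.
Local Open Scope ring_scope.
#[local] Obligation Tactic := idtac.

(** * Preadditive categories

    The vocabulary of abelian categories below (exactness, direct sums,
    almost split sequences, determiners) only refers to composition and to
    the additive structure of the groups of morphisms, so it is stated for an
    arbitrary preadditive category. *)

Record preadd_cat := PreaddCat {
  ob :> Type;
  mor : ob -> ob -> zmodType;
  idm : forall X, mor X X;
  compm : forall X Y Z, mor Y Z -> mor X Y -> mor X Z;
  compA : forall W X Y Z (h : mor Y Z) (g : mor X Y) (f : mor W X),
    compm h (compm g f) = compm (compm h g) f;
  comp1m : forall X Y (f : mor X Y), compm (idm Y) f = f;
  compm1 : forall X Y (f : mor X Y), compm f (idm X) = f;
  compDl : forall X Y Z (g g' : mor Y Z) (f : mor X Y),
    compm (g + g') f = compm g f + compm g' f;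
  compDr : forall X Y Z (g : mor Y Z) (f f' : mor X Y),
    compm g (f + f') = compm g f + compm g f'
}.
Arguments mor {C} X Y : rename.
Arguments idm {C} X : rename.
Arguments compm {C X Y Z} g f : rename.

Declare Scope cat_scope.
Delimit Scope cat_scope with cat.
Local Open Scope cat_scope.
Notation "g ** f" := (compm g f) (at level 40, left associativity) : cat_scope.

Definition full_subcat (C : preadd_cat) (P : C -> Prop) : preadd_cat :=
  @PreaddCat {X : C | P X} (fun X Y => mor (sval X) (sval Y))
    (fun X => idm (sval X)) (fun X Y Z g f => g ** f)
    (fun W X Y Z h g f => compA h g f)
    (fun X Y f => comp1m f) (fun X Y f => compm1 f)
    (fun X Y Z g g' f => compDl g g' f) (fun X Y Z g f f' => compDr g f f').

Section CategoryNotions.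
Variable C : preadd_cat.
Implicit Types X Y Z A B : C.

Definition isomorphism X Y (f : mor X Y) :=
  exists g : mor Y X, g ** f = idm X /\ f ** g = idm Y.

Definition split_mono X Y (f : mor X Y) :=
  exists r : mor Y X, r ** f = idm X.

Definition split_epi X Y (f : mor X Y) :=
  exists s : mor Y X, f ** s = idm Y.

Definition epi X Y (f : mor X Y) :=
  forall Z (u v : mor Y Z), u ** f = v ** f -> u = v.

Definition is_kernel X Y Z (t : mor Y Z) (s : mor X Y) :=
  t ** s = 0 /\
  forall W (u : mor W Y), t ** u = 0 -> exists! v : mor W X, s ** v = u.

Definition is_cokernel X Y Z (s : mor X Y) (t : mor Y Z) :=
  t ** s = 0 /\
  forall W (u : mor Y W), u ** s = 0 -> exists! v : mor Z W, v ** t = u.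

(* Exactness of 0 -> X -> Y -> Z -> 0. *)
Definition short_exact X Y Z (s : mor X Y) (t : mor Y Z) :=
  is_kernel t s /\ is_cokernel s t.

Definition is_zero X := idm X = 0.

Definition is_direct_sum X Y S :=
  exists (i1 : mor X S) (i2 : mor Y S) (p1 : mor S X) (p2 : mor S Y),
    [/\ p1 ** i1 = idm X, p2 ** i2 = idm Y, p1 ** i2 = 0, p2 ** i1 = 0
      & i1 ** p1 + i2 ** p2 = idm S].

Definition indecomposable X :=
  ~ is_zero X /\ forall Y Z, is_direct_sum Y Z X -> is_zero Y \/ is_zero Z.

(* Full subcategories are given by their objects. The first clause is the
   empty direct sum; when C has a zero object, closure under isomorphism is a
   case of the third. *)
Definition subcategory (D : C -> Prop) :=
  [/\ forall X, is_zero X -> D X,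
      forall X Y S, is_direct_sum X Y S -> D X -> D Y -> D S
    & forall X Y S, is_direct_sum X Y S -> D S -> D X /\ D Y].

(* The smallest subcategory containing the objects in G. *)
Definition generated_subcategory (G : C -> Prop) X :=
  forall D, subcategory D -> (forall Y, G Y -> D Y) -> D X.

Definition left_almost_split A B (g : mor A B) :=
  ~ split_mono g /\
  forall Z (f : mor A Z), ~ split_mono f -> exists h : mor B Z, h ** g = f.

Definition right_almost_split B A (g : mor B A) :=
  ~ split_epi g /\
  forall Z (f : mor Z A), ~ split_epi f -> exists h : mor Z B, g ** h = f.

Definition left_minimal A B (g : mor A B) :=
  forall h : mor B B, h ** g = g -> isomorphism h.

Definition minimal_left_almost_split A B (g : mor A B) :=
  left_minimal g /\ left_almost_split g.

Definition almost_split_sequence A B Z (s : mor A B) (t : mor B Z) :=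
  [/\ short_exact s t, left_almost_split s & right_almost_split t].

Definition left_Auslander_Reiten :=
  forall A, indecomposable A ->
    (exists B (g : mor A B), minimal_left_almost_split g /\ epi g) \/
    (exists B Z (s : mor A B) (t : mor B Z), almost_split_sequence s t).

Definition factors_through X' X Y (f' : mor X' Y) (f : mor X Y) :=
  exists h : mor X' X, f ** h = f'.

Definition right_determined X Y (f : mor X Y) (D : C -> Prop) :=
  forall X' (f' : mor X' Y),
    factors_through f' f <->
    (forall Z, D Z -> forall g : mor Z X', factors_through (f' ** g) f).

Definition right_determiner X Y (f : mor X Y) (D : C -> Prop) :=
  subcategory D /\ right_determined f D.

Definition minimal_right_determiner X Y (f : mor X Y) (D : C -> Prop) :=
  right_determiner f D /\
  ~ exists D', [/\ right_determiner f D', forall Z, D' Z -> D Z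
                 & exists Z, D Z /\ ~ D' Z].

Definition has_unique_minimal_right_determiner X Y (f : mor X Y) :=
  exists D, minimal_right_determiner f D /\
    forall D', minimal_right_determiner f D' -> forall Z, D' Z <-> D Z.

End CategoryNotions.

(** * Quivers *)

Record quiver := Quiver {
  vertex :> Type;
  arrow : vertex -> vertex -> Type
}.
Arguments arrow {Q} x y : rename.

Section QuiverNotions.
Variable Q : quiver.

Inductive qpath (x : Q) : Q -> Type :=
| qpath_nil : qpath x x
| qpath_snoc y z : qpath x y -> arrow y z -> qpath x z.

Definition locally_finite :=
  forall x : Q, finite_set [set: {y : Q & arrow x y}] /\
                finite_set [set: {y : Q & arrow y x}].

Definition interval_finite := forall x y : Q, finite_set [set: qpath x y].

Definition strongly_locally_finite := locally_finite /\ interval_finite.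

Definition has_right_infinite_path :=
  exists v : nat -> Q, inhabited (forall n, arrow (v n) (v n.+1)).

End QuiverNotions.

(** * Locally finite dimensional representations *)

Section Representations.
Variables (k : fieldType) (Q : quiver).

Record representation := Representation {
  rspace :> Q -> vectType k;
  rmap : forall x y, arrow x y -> 'Hom(rspace x, rspace y)
}.

Record rep_hom (M N : representation) := RepHom {
  rhom :> forall x, 'Hom(M x, N x);
  rhomP : forall x y (a : arrow x y),
    (rhom y \o rmap M a)%VF = (rmap N a \o rhom x)%VF
}.

Lemma rep_homP (M N : representation) (f g : rep_hom M N) :
  (forall x, f x = g x) -> f = g.
Proof.
case: f g => f fP [g gP] /= fg.
have {}fg : f = g by apply: functional_extensionality_dep.
by rewrite fg in fP *; rewrite (Prop_irrelevance fP gP).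
Qed.

Section HomGroup.
Variables M N : representation.

HB.instance Definition _ := gen_eqMixin (rep_hom M N).
HB.instance Definition _ := gen_choiceMixin (rep_hom M N).

Program Definition rep_hom0 : rep_hom M N := @RepHom M N (fun x => 0) _.
Next Obligation. by move=> x y a; rewrite comp_lfun0l comp_lfun0r. Qed.

Program Definition rep_homN (f : rep_hom M N) : rep_hom M N :=
  @RepHom M N (fun x => - f x) _.
Next Obligation.
by move=> f x y a; rewrite comp_lfunNl comp_lfunNr rhomP.
Qed.

Program Definition rep_homD (f g : rep_hom M N) : rep_hom M N :=
  @RepHom M N (fun x => f x + g x) _.
Next Obligation.
by move=> f g x y a; rewrite comp_lfunDl comp_lfunDr !rhomP.
Qed.

Fact rep_homDA : associative rep_homD.
Proof. by move=> f g h; apply: rep_homP => x /=; rewrite addrA. Qed.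

Fact rep_homDC : commutative rep_homD.
Proof. by move=> f g; apply: rep_homP => x /=; rewrite addrC. Qed.

Fact rep_hom0D : left_id rep_hom0 rep_homD.
Proof. by move=> f; apply: rep_homP => x /=; rewrite add0r. Qed.

Fact rep_homND : left_inverse rep_hom0 rep_homN rep_homD.
Proof. by move=> f; apply: rep_homP => x /=; rewrite addNr. Qed.

HB.instance Definition _ := GRing.isZmodule.Build (rep_hom M N)
  rep_homDA rep_homDC rep_hom0D rep_homND.

End HomGroup.

Program Definition rep_id (M : representation) : rep_hom M M :=
  @RepHom M M (fun x => \1%VF) _.
Next Obligation. by move=> M x y a; rewrite comp_lfun1l comp_lfun1r. Qed.

Program Definition rep_comp (L M N : representation)
    (g : rep_hom M N) (f : rep_hom L M) : rep_hom L N :=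
  @RepHom L N (fun x => (g x \o f x)%VF) _.
Next Obligation.
by move=> L M N g f x y a; rewrite -comp_lfunA rhomP comp_lfunA rhomP -comp_lfunA.
Qed.

Program Definition rep : preadd_cat :=
  @PreaddCat representation (fun M N => rep_hom M N : zmodType)
    rep_id rep_comp _ _ _ _ _.
Next Obligation.
by move=> L M N P h g f; apply: rep_homP => x /=; rewrite comp_lfunA.
Qed.
Next Obligation. by move=> M N f; apply: rep_homP => x /=; rewrite comp_lfun1l. Qed.
Next Obligation. by move=> M N f; apply: rep_homP => x /=; rewrite comp_lfun1r. Qed.
Next Obligation.
by move=> L M N g g' f; apply: rep_homP => x /=; rewrite comp_lfunDl.
Qed.
Next Obligation.
by move=> L M N g f f'; apply: rep_homP => x /=; rewrite comp_lfunDr.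
Qed.

(** ** The projectives P_x *)

(* The finite type of paths from x to y. If there are infinitely many of them,
   [fset_set] is empty, so P_x is meaningful for interval finite quivers. *)
Definition fqpath (x y : Q) : finType :=
  fset_set [set: {classic (qpath x y)}].

Definition qpath_of x y (p : fqpath x y) : {classic (qpath x y)} := \val p.

Lemma qpath_of_inj x y : injective (@qpath_of x y).
Proof. exact: val_inj. Qed.

Lemma qpath_of_surj x y (p : qpath x y) :
  interval_finite Q -> exists p' : fqpath x y, qpath_of p' = p.
Proof.
move=> /(_ x y) Qfin.
have pin : (p : {classic (qpath x y)}) \in fset_set [set: {classic (qpath x y)}].
  by rewrite in_fset_set // inE.
by exists [` pin]%fset.
Qed.

Definition projective_map_fun (x y z : Q) (a : arrow y z)
    (u : {ffun fqpath x y -> k^o}) : {ffun fqpath x z -> k^o} :=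
  [ffun q => \sum_(p : fqpath x y |
     (qpath_snoc (qpath_of p) a : {classic (qpath x z)}) == qpath_of q) u p].

Fact projective_map_is_linear x y z (a : arrow y z) :
  linear (@projective_map_fun x y z a).
Proof.
move=> c u v; apply/ffunP=> q; rewrite !ffunE scaler_sumr -big_split /=.
by apply: eq_bigr => p _; rewrite !ffunE.
Qed.

HB.instance Definition _ x y z (a : arrow y z) :=
  GRing.isLinear.Build k _ _ _ (@projective_map_fun x y z a)
    (@projective_map_is_linear x y z a).

(* P_x(y) is the space with basis the paths from x to y, a path being
   identified with its indicator function; P_x(a) sends p to p followed by a. *)
Definition projective (x : Q) : rep :=
  @Representation (fun y => {ffun fqpath x y -> k^o})
    (fun y z a => linfun (@projective_map_fun x y z a)).

Lemma projective_map_path x y z (a : arrow y z)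
    (p : fqpath x y) (q : fqpath x z) :
  qpath_of q = qpath_snoc (qpath_of p) a ->
  rmap (projective x) a [ffun p' => (p' == p)%:R] = [ffun q' => (q' == q)%:R].
Proof.
move=> qE; rewrite lfunE /=; apply/ffunP=> q'; rewrite !ffunE.
rewrite -(inj_eq (@qpath_of_inj x z)) qE eq_sym big_mkcond (bigD1 p) //= ffunE eqxx.
rewrite big1 ?addr0; first by case: ifP.
by move=> p' /negPf p'p; rewrite ffunE p'p if_same.
Qed.

Definition proj_rep : rep -> Prop :=
  generated_subcategory (fun M => exists x, M = projective x).

Definition finitely_presented (M : rep) :=
  exists (P1 P0 : rep) (i : mor P1 P0) (p : mor P0 M),
    [/\ proj_rep P1, proj_rep P0 & short_exact i p].

Definition rep_plus : preadd_cat := full_subcat finitely_presented.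

End Representations.

(* Main.v *)
Require Import Defs.
From mathcomp Require Import all_boot all_order all_algebra finmap.
From HB Require Import structures.
From mathcomp Require Import boolp classical_sets cardinality.

Set Implicit Arguments.
Unset Strict Implicit.
Unset Printing Implicit Defensive.
Import GRing.Theory.
Local Open Scope ring_scope.
Local Open Scope cat_scope.

(** If there is a right infinite path v 0 -> v 1 -> v 2 -> ..., let X_n be the
    quotient of P_(v 0) by P_(v n). As paths between two vertices have bounded
    length, a finitely presented M has no nonzero morphism to P_(v n) for n
    large, and every morphism M -> X_n lifts to P_(v 0) ([lift_ray_quot]).
    Hence a left almost split P_(v 0) -> B would be a section: the projection
    P_(v 0) -> X_n factors through it, and the factor B -> X_n lifts to a
    retraction ([no_left_almost_split]). For the same reason the projection
    f : P_(v 0) -> X_1 has no minimal right determiner: an object Z0 is blind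
    to the difference between f and X_(n+1) -> X_1 for n large, so whatever
    f needs can be detected without Z0
    ([infinite_path_no_minimal_determiner]).

    If there is no right infinite path, then by König's lemma each P_x is
    finite-dimensional, and finitely presented means finite-dimensional
    ([fp_fin_dim], [fin_dim_fp]), so that kernels, pullbacks and pushouts may
    be formed vertexwise. The core is a form of the Auslander-Reiten formula.
    That a morphism f' : M -> Y factors through f : X -> Y is a finite system
    of linear equations, so by duality a failure is witnessed by a linear
    relation, which is a finite family of elements of M; the families that
    define relations are the images of a universal one, in a
    finite-dimensional C. It follows that C alone determines f
    ([linear_duality], [universal_relation], [determined_by_object]).

    As indecomposable objects have local endomorphism rings
    ([rep_plus_local]), a minimality argument over the summands of C refines
    every failure to factor to one by an indecomposable Z that disappears
    after composition with any non-split epimorphism to Z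
    ([rep_plus_has_almost_factoring]). Such Z belong to all right determiners
    of f, hence generate the unique minimal one
    ([unique_minimal_right_determiner]). Applied to the identity of the
    cokernel of a non-split monomorphism A -> X, the same refinement gives an
    almost split sequence starting at A, by pullback
    ([almost_split_sequence_exists]); if every monomorphism out of A splits,
    then A modulo a simple subobject is the required epimorphism
    ([quotient_by_socle_almost_split]). *)

(* Unqualified, [compA] is the associativity of function composition. *)
Notation compmA := Defs.compA.

(** * Invertibility in rings without nontrivial idempotents *)

Section RingLemmas.

Lemma nilpotent_sub1_inv (R : pzRingType) (x : R) n :
  x ^+ n = 0 -> exists y, y * (1 - x) = 1 /\ (1 - x) * y = 1.
Proof.
move=> xn0; exists (\sum_(i < n) x ^+ i).
have E : (1 - x) * (\sum_(i < n) x ^+ i) = 1.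
  by rewrite -opprB mulNr -subrX1 xn0 sub0r opprK.
split=> //; rewrite -[RHS]E mulr_suml mulr_sumr; apply: eq_bigr => i _.
by rewrite mulrBl mulrBr mulr1 mul1r -exprS -exprSr.
Qed.

(** The element [x ^+ m * y ^+ m] is idempotent. If it is 0, then x is
    nilpotent and a geometric series inverts [1 - x]; if it is 1, then x is
    invertible. *)
Lemma pi_regular_inv_dichotomy (R : pzRingType) (x y : R) m :
    GRing.comm x y -> x ^+ m = x ^+ m.+1 * y ->
    (forall e : R, e * e = e -> e = 0 \/ e = 1) ->
  (exists z, z * x = 1 /\ x * z = 1) \/
  (exists z, z * (1 - x) = 1 /\ (1 - x) * z = 1).
Proof.
move=> xy xm e01.
have xmj j : x ^+ m = x ^+ (m + j) * y ^+ j.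
  elim: j => [|j IH]; first by rewrite addn0 mulr1.
  have -> : x ^+ (m + j.+1) = x ^+ j * x ^+ m.+1 by rewrite -exprD addnS addnC addnS.
  by rewrite (exprS y) -!mulrA (mulrA _ y) -xm mulrA -exprD addnC -IH.
set e := x ^+ m * y ^+ m.
have cxm : GRing.comm (x ^+ m) (y ^+ m) by apply/commrX/commr_sym/commrX/commr_sym.
have eE : e * x ^+ m = x ^+ m.
  by rewrite /e -mulrA -cxm mulrA -exprD -xmj.
have ee : e * e = e by rewrite {2}/e mulrA eE.
case: (e01 e ee) => e0.
  right; apply: (@nilpotent_sub1_inv _ x m).
  by rewrite -eE e0 mul0r.
left; case: m @e xm xmj cxm eE ee e0 => [|m] e xm xmj cxm eE ee e0.
  exists y; rewrite expr0 expr1 in xm.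
  by rewrite -xm; split=> //; rewrite -xy.
have := e0; rewrite /e => e1.
have cxym : GRing.comm x (y ^+ m.+1) by apply: commrX.
have cxxy : GRing.comm x (x ^+ m * y ^+ m.+1).
  by apply: commrM => //; apply: commrX.
by exists (x ^+ m * y ^+ m.+1); rewrite -cxxy mulrA -exprS.
Qed.

End RingLemmas.

(** * Preadditive categories *)

Section Cat.
Variable C : preadd_cat.
Implicit Types X Y Z A B W : C.

Lemma comp0m X Y Z (f : mor X Y) : (0 : mor Y Z) ** f = 0.
Proof. by apply: (addrI ((0 : mor Y Z) ** f)); rewrite -compDl !addr0. Qed.

Lemma compm0 X Y Z (g : mor Y Z) : g ** (0 : mor X Y) = 0.
Proof. by apply: (addrI (g ** (0 : mor X Y))); rewrite -compDr !addr0. Qed.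

Lemma compNm X Y Z (g : mor Y Z) (f : mor X Y) : (- g) ** f = - (g ** f).
Proof. by apply: (addrI (g ** f)); rewrite -compDl !subrr comp0m. Qed.

Lemma compmN X Y Z (g : mor Y Z) (f : mor X Y) : g ** (- f) = - (g ** f).
Proof. by apply: (addrI (g ** f)); rewrite -compDr !subrr compm0. Qed.

Lemma compBl X Y Z (g g' : mor Y Z) (f : mor X Y) :
  (g - g') ** f = g ** f - g' ** f.
Proof. by rewrite compDl compNm. Qed.

Lemma compBr X Y Z (g : mor Y Z) (f f' : mor X Y) :
  g ** (f - f') = g ** f - g ** f'.
Proof. by rewrite compDr compmN. Qed.

(** An alias of the group of endomorphisms, to carry the ring structure whose
    product is composition. *)
Definition endo X : Type := mor X X.
HB.instance Definition _ X := GRing.Zmodule.on (endo X).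
Fact endo_mulA X : associative (fun f g : endo X => (f ** g : endo X)).
Proof. by move=> f g h; rewrite /= compmA. Qed.
HB.instance Definition _ X := GRing.Zmodule_isPzRing.Build (endo X)
  (@endo_mulA X) (fun f => comp1m f) (fun f => compm1 f)
  (fun f g h => compDl f g h) (fun f g h => compDr f g h).

Definition idempotents_split := forall X (e : mor X X), e ** e = e ->
  exists (Y : C) (i : mor Y X) (p : mor X Y), p ** i = idm Y /\ i ** p = e.

(** For nonzero X this is locality of the endomorphism ring. *)
Definition local_endo X :=
  forall phi : mor X X, isomorphism phi \/ isomorphism (idm X - phi).

Lemma retract_direct_sum X Y (i : mor Y X) (p : mor X Y) :
  idempotents_split -> p ** i = idm Y ->
  exists Z (i2 : mor Z X) (p2 : mor X Z),
    [/\ p2 ** i2 = idm Z, p ** i2 = 0, p2 ** i = 0 &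
       i ** p + i2 ** p2 = idm X].
Proof.
move=> spl pi.
have [|Z [i2 [p2 [pi2 ip2]]]] := spl X (idm X - i ** p).
  rewrite compBl comp1m compBr compm1 -!compmA (compmA p i p) pi comp1m.
  by rewrite subrr subr0.
exists Z, i2, p2; split=> //.
- rewrite -[i2]compm1 -pi2 (compmA i2) ip2 !compBl comp1m compBr.
  by rewrite -!compmA (compmA p i) pi comp1m subrr.
- rewrite -[p2]comp1m -pi2 -compmA -compmA (compmA i2) ip2 compBl comp1m -compmA pi.
  by rewrite compm1 subrr compm0.
- by rewrite ip2 addrC subrK.
Qed.

Lemma subcategory_retract (D : C -> Prop) X Y (i : mor Y X) (p : mor X Y) :
  idempotents_split -> subcategory D -> p ** i = idm Y -> D X -> D Y.
Proof.
move=> spl [_ _ Dsum] pi DX.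
have [Z [i2 [p2 [a b c d]]]] := retract_direct_sum spl pi.
have DS : is_direct_sum Y Z X by exists i, i2, p, p2.
by have [] := Dsum _ _ _ DS DX.
Qed.

Lemma indecomposable_idempotent X (e : mor X X) :
  idempotents_split -> indecomposable X -> e ** e = e -> e = 0 \/ e = idm X.
Proof.
move=> spl [_ indX] ee.
have [Y [i [p [pi ip]]]] := spl X e ee.
have [Z [i2 [p2 [pi2 pi12 pi21 E]]]] := retract_direct_sum spl pi.
have [|Y0|Z0] := indX Y Z; first by exists i, i2, p, p2.
- by left; rewrite -ip -[i]compm1 Y0 compm0 comp0m.
- by right; rewrite -E ip -[i2]compm1 Z0 compm0 comp0m addr0.
Qed.

Lemma pi_regular_local X :
    idempotents_split -> indecomposable X ->
    (forall x : endo X, exists (m : nat) (y : endo X),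
       GRing.comm x y /\ x ^+ m = x ^+ m.+1 * y) ->
  local_endo X.
Proof.
move=> spl indX pr phi.
have [m [y [cxy xm]]] := pr phi.
have [||] := pi_regular_inv_dichotomy cxy xm.
- by move=> e; apply: indecomposable_idempotent.
- by case=> z [? ?]; left; exists z.
- by case=> z [? ?]; right; exists z.
Qed.

Lemma local_endo_section X A (u : mor X A) (v : mor A X) :
  isomorphism (v ** u) -> split_mono u.
Proof. by case=> w [wl _]; exists (w ** v); rewrite -compmA. Qed.

(** A nonzero retract X of Y is all of Y: of the idempotent [u ** w ** v] and
    its complement, one is invertible, and the complement is killed by v. *)
Lemma local_iso_comp X Y (u : mor X Y) (v : mor Y X) :
  local_endo Y -> ~ is_zero X -> isomorphism (v ** u) ->
  exists w : mor X X, u ** w ** v = idm Y.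
Proof.
move=> locY X0 [w [wl wr]].
pose e := u ** w ** v.
have ee : e ** e = e.
  by rewrite /e -!compmA (compmA v u) (compmA (v ** u)) wr comp1m.
case: (locY e) => [] [z [zl zr]].
  exists w; by rewrite -/e -[LHS]comp1m -{1}zl -compmA ee zl.
exfalso; apply: X0; rewrite /is_zero.
have e0 : e = 0.
  by rewrite -[e]comp1m -zl -compmA compBl comp1m ee subrr compm0.
have : v ** e ** u = v ** u.
  have -> : v ** e ** u = v ** u ** w ** (v ** u) by rewrite /e !compmA.
  by rewrite wr comp1m.
rewrite e0 compm0 comp0m => vu0.
by rewrite -wl -vu0 compm0.
Qed.

Lemma local_sum_iso X (x y : mor X X) :
  local_endo X -> isomorphism (x + y) -> isomorphism x \/ isomorphism y.
Proof.
move=> locX [z [zl zr]].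
have zxy : z ** x + z ** y = idm X by rewrite -compDr.
have unz w : isomorphism (z ** w) -> isomorphism w.
  case=> t [tl tr]; exists (t ** z); split; first by rewrite -compmA.
  have wtz : z ** (w ** t) = idm X by rewrite compmA.
  have -> : w ** (t ** z) = (x + y) ** (z ** w ** t) ** z.
    by rewrite !compmA zr comp1m.
  by rewrite tr compm1.
case: (locX (z ** x)) => [/unz|]; first by left.
by rewrite -{1}zxy addrC addKr => /unz; right.
Qed.

Section Factor.
Variables (X Y : C) (f : mor X Y).

Lemma factors_through0 X' : factors_through (0 : mor X' Y) f.
Proof. by exists 0; rewrite compm0. Qed.

Lemma factors_throughD X' (g h : mor X' Y) :
  factors_through g f -> factors_through h f -> factors_through (g + h) f.
Proof. by move=> [u <-] [v <-]; exists (u + v); rewrite compDr. Qed.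

Lemma factors_through_comp X' X'' (g : mor X' Y) (h : mor X'' X') :
  factors_through g f -> factors_through (g ** h) f.
Proof. by move=> [u <-]; exists (u ** h); rewrite compmA. Qed.

(** A right determiner cannot miss such a g: the only tests r that reveal that g
    does not factor are split epimorphisms onto Z. *)
Definition almost_factors Z (g : mor Z Y) :=
  ~ factors_through g f /\
  forall W (r : mor W Z), ~ split_epi r -> factors_through (g ** r) f.

Definition has_almost_factoring :=
  forall X' (f' : mor X' Y), ~ factors_through f' f ->
    exists Z (g : mor Z X'), indecomposable Z /\ almost_factors (f' ** g).

Lemma generated_subcategory_subcategory (G : C -> Prop) :
  subcategory (generated_subcategory G).
Proof.
split=> [Z Z0 D DD _ | A B S AB GA GB D DD GD | A B S AB GS].
- by have [D0 _ _] := DD; apply: D0.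
- by have [_ D1 _] := DD; apply: (D1 _ _ _ AB); [apply: GA | apply: GB].
- by split=> D DD GD; have [_ _ D2] := DD; have [] := D2 _ _ _ AB (GS D DD GD).
Qed.

Lemma right_determiner_almost_factors (D : C -> Prop) Z (g : mor Z Y) :
  idempotents_split -> right_determiner f D -> almost_factors g -> D Z.
Proof.
move=> spl [DD Df] [gf gal].
have /existsNP[W /not_implyP[DW /existsNP[r gr]]] :
    ~ forall W, D W -> forall r : mor W Z, factors_through (g ** r) f.
  by move=> /Df.
have [s rs] : split_epi r by apply: contrapT => /gal.
exact: subcategory_retract spl DD rs DW.
Qed.

(** The sources of the almost factoring morphisms lie in every right
    determiner; if they detect every failure to factor, then they generate a
    right determiner, which is therefore the least one. *)
Lemma unique_minimal_right_determiner :
  idempotents_split -> has_almost_factoring ->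
  has_unique_minimal_right_determiner f.
Proof.
move=> spl alm.
pose G Z := indecomposable Z /\ exists g : mor Z Y, almost_factors g.
pose D := generated_subcategory G.
have DD : subcategory D by apply: generated_subcategory_subcategory.
have Ddet : right_determiner f D.
  split=> // X' f'; split=> [ff' Z _ g | H]; first exact: factors_through_comp.
  apply: contrapT => nf; have [Z [g [indZ ag]]] := alm _ _ nf.
  have [nfg _] := ag; apply: nfg; apply: H => D' _; apply; split=> //.
  by exists (f' ** g).
have Dmin D' : right_determiner f D' -> forall Z, D Z -> D' Z.
  move=> D'det Z; apply; first by case: D'det.
  by move=> W [_ [g ag]]; apply: right_determiner_almost_factors ag.
exists D; split.
  by split=> // -[D' [/Dmin DD' _ [Z [DZ D'Z]]]]; apply/D'Z/DD'.
move=> D' [D'det D'min] Z; split=> [D'Z|]; last exact: Dmin.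
apply: contrapT => DZ; apply: D'min; exists D; split=> //; first exact: Dmin.
by exists Z.
Qed.

End Factor.

End Cat.

(** * Vertexwise exactness *)

Notation "M ~> N" := (@mor (rep _ _) M N) (at level 70) : cat_scope.

Section Pointwise.
Variables (k : fieldType) (Q : quiver).
Notation Rep := (representation k Q).
Implicit Types L M N P : Rep.

Lemma rhom_comp L M N (g : M ~> N) (f : L ~> M) x u :
  rhom (g ** f) x u = rhom g x (rhom f x u).
Proof. exact: comp_lfunE. Qed.

Lemma rhom_id M x u : rhom (idm (M : rep k Q)) x u = u.
Proof. exact: id_lfunE. Qed.

Lemma rhom0 M N x u : rhom (0 : M ~> N) x u = 0.
Proof. exact: zero_lfunE. Qed.

Lemma rhomD M N (f g : M ~> N) x u :
  rhom (f + g) x u = rhom f x u + rhom g x u.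
Proof. exact: add_lfunE. Qed.

Lemma rhomN M N (f : M ~> N) x u : rhom (- f) x u = - rhom f x u.
Proof. exact: opp_lfunE. Qed.

Lemma rhomB M N (f g : M ~> N) x u :
  rhom (f - g) x u = rhom f x u - rhom g x u.
Proof. by rewrite rhomD rhomN. Qed.

Definition rhomE := (rhom_comp, rhom_id, rhom0, rhomB, rhomD, rhomN).

Lemma rhomZ M N (f : M ~> N) x c u : rhom f x (c *: u) = c *: rhom f x u.
Proof. exact: linearZ. Qed.

Lemma rhomDr M N (f : M ~> N) x u v : rhom f x (u + v) = rhom f x u + rhom f x v.
Proof. exact: linearD. Qed.

Lemma rhom_sum M N (f : M ~> N) x (I : finType) (F : I -> M x) :
  rhom f x (\sum_i F i) = \sum_i rhom f x (F i).
Proof. exact: linear_sum. Qed.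

Lemma rhom_nat M N (f : M ~> N) x y (a : arrow x y) u :
  rhom f y (rmap M a u) = rmap N a (rhom f x u).
Proof. by rewrite -!comp_lfunE rhomP. Qed.

Lemma rhom_eqP M N (f g : M ~> N) :
  (forall x u, rhom f x u = rhom g x u) <-> f = g.
Proof.
split=> [fg | -> //]; apply: rep_homP => x; apply/lfunP => u; exact: fg.
Qed.

Definition pw_inj M N (f : M ~> N) := forall x u, rhom f x u = 0 -> u = 0.
Definition pw_surj M N (f : M ~> N) := forall x v, exists u, rhom f x u = v.
Definition pw_exact L M N (g : M ~> N) (f : L ~> M) :=
  forall x u, rhom g x u = 0 <-> exists w, rhom f x w = u.

Lemma pw_injP M N (f : M ~> N) x : pw_inj f -> injective (rhom f x).
Proof.
move=> fi u v /eqP; rewrite -subr_eq0 -linearB => /eqP /fi /eqP.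
by rewrite subr_eq0 => /eqP.
Qed.

Lemma pw_inj_lker M N (f : M ~> N) x : pw_inj f -> lker (rhom f x) == 0%VS.
Proof. by move=> fi; apply/lker0P/pw_injP. Qed.

Lemma pw_inj_cancel L M N (f : M ~> N) (g h : L ~> M) :
  pw_inj f -> f ** g = f ** h -> g = h.
Proof.
move=> fi /rhom_eqP fgh; apply/rhom_eqP => x u; apply: (pw_injP fi).
by have := fgh x u; rewrite !rhomE.
Qed.

Lemma pw_surj_cancel L M N (f : L ~> M) (g h : M ~> N) :
  pw_surj f -> g ** f = h ** f -> g = h.
Proof.
move=> fs /rhom_eqP fgh; apply/rhom_eqP => x u; have [w <-] := fs x u.
by have := fgh x w; rewrite !rhomE.
Qed.

Lemma lift_mono L M N (s : M ~> N) (g : L ~> N) :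
  pw_inj s -> (forall x u, exists w, rhom s x w = rhom g x u) ->
  exists h : L ~> M, s ** h = g.
Proof.
move=> si sg.
pose h x := ((rhom s x)^-1 \o rhom g x)%VF.
have sh x u : rhom s x (h x u) = rhom g x u.
  rewrite comp_lfunE limg_lfunVK //; have [w <-] := sg x u.
  by rewrite memv_img ?memvf.
clearbody h.
have hP x y (a : arrow x y) : (h y \o rmap L a)%VF = (rmap M a \o h x)%VF.
  apply/lfunP => u; apply: (pw_injP si).
  by rewrite !comp_lfunE sh !rhom_nat sh.
exists (RepHom hP); apply/rhom_eqP => x u; rewrite rhom_comp; exact: sh.
Qed.

Lemma desc_epi L M N (p : L ~> M) (g : L ~> N) :
  pw_surj p -> (forall x u, rhom p x u = 0 -> rhom g x u = 0) ->
  exists h : M ~> N, h ** p = g.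
Proof.
move=> ps pg.
pose h x := (rhom g x \o (rhom p x)^-1)%VF.
have hp x u : h x (rhom p x u) = rhom g x u.
  rewrite comp_lfunE; apply/eqP; rewrite -subr_eq0 -linearB; apply/eqP/pg.
  by rewrite linearB /= limg_lfunVK ?subrr // memv_img ?memvf.
clearbody h.
have hP x y (a : arrow x y) : (h y \o rmap M a)%VF = (rmap N a \o h x)%VF.
  apply/lfunP => v; have [u <-] := ps x v.
  by rewrite [LHS]comp_lfunE [RHS]comp_lfunE hp -rhom_nat hp rhom_nat.
exists (RepHom hP); apply/rhom_eqP => x u; rewrite rhom_comp; exact: hp.
Qed.

Lemma pw_short_exact L M N (s : L ~> M) (t : M ~> N) :
  pw_inj s -> pw_surj t -> pw_exact t s -> short_exact s t.
Proof.
move=> si ts ex.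
have ts0 : t ** s = 0.
  by apply/rhom_eqP => x u; rewrite !rhomE; apply/ex; exists u.
split; split=> // W u.
  move=> tu0; have [|v sv] := @lift_mono W L M s u si.
    move=> x w; apply/ex; have /rhom_eqP/(_ x w) := tu0.
    by rewrite !rhomE.
  exists v; split=> // v' sv'; apply: (pw_inj_cancel si); by rewrite sv.
move=> us0; have [|v sv] := @desc_epi M N W t u ts.
  move=> x w /ex[w' <-]; have /rhom_eqP/(_ x w') := us0.
  by rewrite !rhomE.
exists v; split=> // v' sv'; apply: (pw_surj_cancel ts); by rewrite sv.
Qed.

Lemma pw_exact_comp0 L M N (s : L ~> M) (t : M ~> N) :
  pw_exact t s -> t ** s = 0.
Proof. by move=> ex; apply/rhom_eqP => x u; rewrite !rhomE; apply/ex; exists u. Qed.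

Lemma comp0_at L M N (s : L ~> M) (t : M ~> N) x u :
  t ** s = 0 -> rhom t x (rhom s x u) = 0.
Proof. by move=> /rhom_eqP/(_ x u); rewrite !rhomE. Qed.

Lemma lift_kernel L M N W (s : L ~> M) (t : M ~> N) (g : W ~> M) :
  pw_inj s -> pw_exact t s -> t ** g = 0 -> exists h, s ** h = g.
Proof. by move=> si ex tg; apply: lift_mono => // x u; apply/ex/comp0_at. Qed.

Lemma desc_cokernel L M N W (s : L ~> M) (t : M ~> N) (g : M ~> W) :
  pw_surj t -> pw_exact t s -> g ** s = 0 -> exists h, h ** t = g.
Proof.
move=> ts ex gs; apply: desc_epi => // x u /ex[w <-]; exact: comp0_at.
Qed.

Section Sub.
Variables (M : Rep) (U : forall x, {vspace M x}).
Hypothesis U_stable : forall x y (a : arrow x y) u, u \in U x -> rmap M a u \in U y.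

Definition subrep_map x y (a : arrow x y) : 'Hom(subvs_of (U x), subvs_of (U y)) :=
  (linfun (vsproj (U y)) \o rmap M a \o linfun vsval)%VF.

Definition subrep : Rep :=
  @Representation k Q (fun x => subvs_of (U x)) subrep_map.

Fact subrep_incl_nat x y (a : arrow x y) :
  (linfun vsval \o rmap subrep a)%VF = (rmap M a \o linfun vsval)%VF.
Proof.
apply/lfunP => u; rewrite /= /subrep_map !comp_lfunE !lfunE /= vsprojK //.
exact/U_stable/subvsP.
Qed.

Definition subrep_incl : subrep ~> M :=
  @RepHom k Q subrep M (fun x => linfun vsval) subrep_incl_nat.

Lemma subrep_incl_inj : pw_inj subrep_incl.
Proof. by move=> x u; rewrite /= lfunE /= => u0; apply: val_inj. Qed.

Lemma subrep_incl_img x u : (exists w, rhom subrep_incl x w = u) <-> u \in U x.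
Proof.
split=> [[w <-] | uU]; first by rewrite /= lfunE /= subvsP.
by exists (Subvs uU); rewrite /= lfunE.
Qed.

End Sub.

Lemma subrep_exists M (U : forall x, {vspace M x}) :
  (forall x y (a : arrow x y) u, u \in U x -> rmap M a u \in U y) ->
  exists (N : Rep) (i : N ~> M),
    pw_inj i /\ forall x u, (exists w, rhom i x w = u) <-> u \in U x.
Proof.
move=> st; exists (subrep U), (subrep_incl st).
by split; [exact: subrep_incl_inj | exact: subrep_incl_img].
Qed.

Lemma kernel_exists M N (f : M ~> N) :
  exists (K : Rep) (i : K ~> M), pw_inj i /\ pw_exact f i.
Proof.
have [|K [i [ii iU]]] := @subrep_exists M (fun x => lker (rhom f x)).
  move=> x y a u; rewrite !memv_ker rhom_nat => /eqP ->.
  by rewrite linear0.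
exists K, i; split=> // x u; split=> [fu0 | /iU]; last by rewrite memv_ker => /eqP.
by apply/iU; rewrite memv_ker fu0.
Qed.

Lemma image_exists M N (f : M ~> N) :
  exists (I : Rep) (p : M ~> I) (i : I ~> N),
    [/\ pw_surj p, pw_inj i & i ** p = f].
Proof.
have [|I [i [ii iU]]] := @subrep_exists N (fun x => limg (rhom f x)).
  by move=> x y a u /memv_imgP[v _ ->]; rewrite -rhom_nat memv_img ?memvf.
have fi x u : exists w, rhom i x w = rhom f x u by apply/iU; rewrite memv_img ?memvf.
have [p ip] := lift_mono ii fi; exists I, p, i; split=> // x v.
have /iU/memv_imgP[u _ E] : exists w, rhom i x w = rhom i x v by exists v.
by exists u; apply: (pw_injP ii); rewrite E -ip rhomE.
Qed.

(** A complement of U serves as the quotient by U. *)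
Lemma quotient_space (V : vectType k) (U : {vspace V}) :
  exists (W : vectType k) (q : 'Hom(V, W)) (s : 'Hom(W, V)),
    (forall w, q (s w) = w) /\ forall u, q u = 0 <-> u \in U.
Proof.
exists (subvs_of U^C%VS), (linfun (vsproj U^C%VS) \o (\1 - projv U))%VF, (linfun vsval).
have qE u : (linfun (vsproj U^C%VS) \o (\1 - projv U))%VF u = vsproj U^C%VS (u - projv U u).
  by rewrite comp_lfunE lfunE /= add_lfunE opp_lfunE id_lfunE.
split=> [w | u].
  rewrite qE lfunE /=.
  have -> : projv U (vsval w) = 0.
    by apply/eqP; rewrite -memv_ker lker_proj subvsP.
  by rewrite subr0 vsvalK.
rewrite qE; split=> [/(congr1 vsval) | uU]; last by rewrite projv_id // subrr linear0.
rewrite vsprojK ?memv_projC //= => /eqP; rewrite subr_eq0 => /eqP ->.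
exact: memv_proj.
Qed.

Lemma quotient_exists M (U : forall x, {vspace M x}) :
  (forall x y (a : arrow x y) u, u \in U x -> rmap M a u \in U y) ->
  exists (C : Rep) (q : M ~> C),
    pw_surj q /\ forall x u, rhom q x u = 0 <-> u \in U x.
Proof.
move=> st.
have ex x : {W : vectType k & {q : 'Hom(M x, W) & {s : 'Hom(W, M x) |
    (forall w, q (s w) = w) /\ forall u, q u = 0 <-> u \in U x}}}.
  have [W /cid[q /cid[s H]]] := cid (quotient_space (U x)).
  by exists W, q, s.
pose W x := projT1 (ex x).
pose q x : 'Hom(M x, W x) := projT1 (projT2 (ex x)).
pose s x : 'Hom(W x, M x) := sval (projT2 (projT2 (ex x))).
have qs x w : q x (s x w) = w by have [H _] := svalP (projT2 (projT2 (ex x))); apply: H.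
have qU x u : q x u = 0 <-> u \in U x by have [_ H] := svalP (projT2 (projT2 (ex x))); apply: H.
pose C : Rep := @Representation k Q W (fun x y a => (q y \o rmap M a \o s x)%VF).
have qP x y (a : arrow x y) : (q y \o rmap M a)%VF = (rmap C a \o q x)%VF.
  apply/lfunP => u; rewrite /= !comp_lfunE; apply/eqP.
  rewrite -subr_eq0 -!linearB; apply/eqP/qU/st/qU.
  by rewrite linearB /= qs subrr.
exists C, (@RepHom k Q M C q qP); split=> // x v.
by exists (s x v) => /=; rewrite qs.
Qed.

Lemma cokernel_exists M N (f : M ~> N) :
  exists (C : Rep) (q : N ~> C), pw_surj q /\ pw_exact q f.
Proof.
have [|C [q [qs qU]]] := @quotient_exists N (fun x => limg (rhom f x)).
  by move=> x y a u /memv_imgP[v _ ->]; rewrite -rhom_nat memv_img ?memvf.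
exists C, q; split=> // x u; split=> [/qU/memv_imgP[w _ ->] | [w <-]]; first by exists w.
by apply/qU; rewrite memv_img ?memvf.
Qed.

Section DirectSum.
Variables M N : Rep.

Let pair_map x y (a : arrow x y) (u : M x * N x) : M y * N y :=
  (rmap M a u.1, rmap N a u.2).
Let pair_map_linear x y a : linear (@pair_map x y a).
Proof. by move=> c u v; rewrite /pair_map /= !linearP. Qed.
HB.instance Definition _ x y a :=
  GRing.isLinear.Build k _ _ _ (@pair_map x y a) (@pair_map_linear x y a).

Let S : Rep := @Representation k Q (fun x => (M x * N x)%type)
  (fun x y a => linfun (@pair_map x y a)).

Let in1 x (u : M x) : M x * N x := (u, 0).
Let in2 x (u : N x) : M x * N x := (0, u).
Let in1_linear x : linear (@in1 x).
Proof. by move=> c u v; apply/pair_equal_spec; split; rewrite //= scaler0 addr0. Qed.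
Let in2_linear x : linear (@in2 x).
Proof. by move=> c u v; apply/pair_equal_spec; split; rewrite //= scaler0 addr0. Qed.
HB.instance Definition _ x :=
  GRing.isLinear.Build k _ _ _ (@in1 x) (@in1_linear x).
HB.instance Definition _ x :=
  GRing.isLinear.Build k _ _ _ (@in2 x) (@in2_linear x).

Lemma direct_sum_exists : exists S : Rep, @is_direct_sum (rep k Q) M N S.
Proof.
exists S.
have P1 x y (a : arrow x y) :
    (linfun (@in1 y) \o rmap M a)%VF = (rmap S a \o linfun (@in1 x))%VF.
  apply/lfunP => u; rewrite !comp_lfunE !lfunE /=.
  by rewrite /pair_map /= linear0.
have P2 x y (a : arrow x y) :
    (linfun (@in2 y) \o rmap N a)%VF = (rmap S a \o linfun (@in2 x))%VF.
  apply/lfunP => u; rewrite !comp_lfunE !lfunE /=.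
  by rewrite /pair_map /= linear0.
have P3 x y (a : arrow x y) :
    (linfun (@fst (M y) (N y)) \o rmap S a)%VF = (rmap M a \o linfun (@fst (M x) (N x)))%VF.
  by apply/lfunP => u; rewrite !comp_lfunE !lfunE.
have P4 x y (a : arrow x y) :
    (linfun (@snd (M y) (N y)) \o rmap S a)%VF = (rmap N a \o linfun (@snd (M x) (N x)))%VF.
  by apply/lfunP => u; rewrite !comp_lfunE !lfunE.
exists (@RepHom k Q M S _ P1), (@RepHom k Q N S _ P2),
  (@RepHom k Q S M _ P3), (@RepHom k Q S N _ P4).
split; apply/rhom_eqP => x u; rewrite !rhomE /= !lfunE //=.
by case: u => u v; apply/pair_equal_spec; rewrite /= addr0 add0r.
Qed.

End DirectSum.

Lemma pw_iso M N (f : M ~> N) : pw_inj f -> pw_surj f -> isomorphism f.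
Proof.
move=> fi fs.
have [|g fg] := @lift_mono N M N f (idm (N : rep k Q)) fi.
  by move=> x u; rewrite rhomE.
exists g; split=> //; apply: (pw_inj_cancel fi).
by rewrite compmA fg comp1m compm1.
Qed.

Lemma split_mono_pw_inj M N (f : M ~> N) : split_mono f -> pw_inj f.
Proof.
move=> [r rf] x u fu0; have /rhom_eqP/(_ x u) := rf.
by rewrite !rhomE fu0 linear0.
Qed.

Lemma split_epi_pw_surj M N (f : M ~> N) : split_epi f -> pw_surj f.
Proof.
move=> [s fs] x u; have /rhom_eqP/(_ x u) := fs.
by rewrite !rhomE => E; exists (rhom s x u).
Qed.

Lemma rep_idempotents_split : idempotents_split (rep k Q).
Proof.
move=> M e ee; have [I [p [i [ps ii ip]]]] := @image_exists M M e.
exists I, i, p; split=> //; apply: (pw_surj_cancel ps); apply: (pw_inj_cancel ii).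
by rewrite comp1m ip !compmA ip -compmA ip.
Qed.

(** Kernels, images and cokernels exist vertexwise, and the universal properties
    identify them with the given s and t. *)
Lemma short_exact_pw L M N (s : L ~> M) (t : M ~> N) :
  short_exact s t -> [/\ pw_inj s, pw_surj t & pw_exact t s].
Proof.
move=> [[ts0 ker] [_ coker]].
have [K [i [ii ie]]] := kernel_exists t.
have [v [sv _]] := ker K i (pw_exact_comp0 ie).
have [h ih] := lift_kernel ii ie ts0.
have si : pw_inj s.
  have vh : v ** h = idm (L : rep k Q).
    have [w [_ wu]] := ker L s ts0.
    by rewrite -(wu (v ** h)) ?compmA ?sv // -(wu (idm _)) ?compm1.
  move=> x u su0; have /rhom_eqP/(_ x u) := vh; rewrite !rhomE.
  have -> : rhom h x u = 0 by apply: (ii); rewrite -rhom_comp ih.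
  by rewrite linear0.
have ex : pw_exact t s.
  move=> x u; split=> [/ie[w <-] | [w <-]]; last exact: comp0_at.
  by exists (rhom v x w); rewrite -rhom_comp sv.
split=> //; have [I [p [j [ps ji jp]]]] := image_exists t.
have [|w [wt _]] := coker I p.
  by apply: (pw_inj_cancel ji); rewrite compmA jp ts0 compm0.
have jw : j ** w = idm (N : rep k Q).
  have [z [_ zu]] := coker N t ts0.
  by rewrite -(zu (j ** w)) -?compmA ?wt ?jp // -(zu (idm _)) ?comp1m.
by move=> x u; have := split_epi_pw_surj (ex_intro _ w jw) u => -[y <-];
   have [z <-] := ps x y; exists z; rewrite -rhom_comp jp.
Qed.

Lemma pw_inj_dim M N (f : M ~> N) x : pw_inj f -> (\dim {: M x} <= \dim {: N x})%N.
Proof.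
move=> fi; rewrite -(limg_dim_eq (f := rhom f x) (U := fullv)) ?dimvS ?subvf //.
by rewrite (eqP (pw_inj_lker x fi)) capv0.
Qed.

Lemma pw_surj_limg M N (f : M ~> N) x : pw_surj f -> limg (rhom f x) = fullv.
Proof.
move=> fs; apply/eqP; rewrite eqEsubv subvf; apply/subvP => v _.
by have [u <-] := fs x v; rewrite memv_img ?memvf.
Qed.

Lemma pw_surj_dim M N (f : M ~> N) x : pw_surj f -> (\dim {: N x} <= \dim {: M x})%N.
Proof.
by move=> fs; rewrite -(pw_surj_limg x fs) -(limg_ker_dim (rhom f x) fullv) leq_addl.
Qed.

End Pointwise.

(** * Paths *)

Section Paths.
Variable Q : quiver.

Fixpoint qcat (x y : Q) (c : qpath x y) z (p : qpath y z) : qpath x z :=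
  match p in qpath _ z return qpath x z with
  | qpath_nil => c
  | qpath_snoc _ _ p a => qpath_snoc (qcat c p) a
  end.

Fixpoint qlen (x z : Q) (p : qpath x z) : nat :=
  if p is qpath_snoc _ _ p _ then (qlen p).+1 else 0%N.

Definition qarr (x y : Q) (a : arrow x y) : qpath x y := qpath_snoc (qpath_nil x) a.

Lemma qcat_nil (x z : Q) (p : qpath x z) : qcat (qpath_nil x) p = p.
Proof. by elim: p => //= y z' p ->. Qed.

Lemma qlen_cat (x y z : Q) (c : qpath x y) (p : qpath y z) :
  qlen (qcat c p) = (qlen c + qlen p)%N.
Proof. by elim: p => [|y' z' p /= ->]; rewrite ?addn0 ?addnS. Qed.

Lemma existT_inj (T : Type) (P : T -> Type) x (u v : P x) :
  existT P x u = existT P x v -> u = v.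
Proof.
move=> e; have := projT2_eq e.
by rewrite (Prop_irrelevance (projT1_eq e) (erefl x)).
Qed.

Definition unsnoc (x z : Q) (p : qpath x z) :
    option {y : Q & (qpath x y * arrow y z)%type} :=
  match p in qpath _ z return option {y : Q & (qpath x y * arrow y z)%type} with
  | qpath_nil => None
  | qpath_snoc y _ p a => Some (existT (fun y => (qpath x y * arrow y _)%type) y (p, a))
  end.

Lemma qlen0 (x z : Q) (p : qpath x z) :
  qlen p = 0%N -> existT (qpath x) z p = existT (qpath x) x (qpath_nil x).
Proof. by case: p. Qed.

Lemma qlen0_nil (x : Q) (p : qpath x x) : qlen p = 0%N -> p = qpath_nil x.
Proof. by move=> p0; apply: existT_inj (qlen0 p0). Qed.

Lemma qpath_case (x z : Q) (p : qpath x z) :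
  qlen p = 0%N \/ exists y (q : qpath x y) (a : arrow y z), p = qpath_snoc q a.
Proof. by case: p => [|y {}z p a]; [left | right; exists y, p, a]. Qed.

Lemma qsnoc_inj (x y y' z : Q) (p : qpath x y) (a : arrow y z)
    (p' : qpath x y') (a' : arrow y' z) :
  qpath_snoc p a = qpath_snoc p' a' ->
  existT (fun y => (qpath x y * arrow y z)%type) y (p, a) = existT _ y' (p', a').
Proof. by move=> e; have /= E := congr1 (@unsnoc x z) e; apply: (Some_inj E). Qed.

Lemma qcat_inj (x y z : Q) (c : qpath x y) (p p' : qpath y z) :
  qcat c p = qcat c p' -> p = p'.
Proof.
elim: p p' => [|w {}z p IH a] p' e; have := congr1 (@qlen x _) e;
  rewrite !qlen_cat => /eqP; rewrite eqn_add2l /= => /eqP len.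
  exact/esym/qlen0_nil.
have [p'0|[w' [q [a' E]]]] := qpath_case p'; first by rewrite p'0 in len.
rewrite {}E in e *; move: e => /= /qsnoc_inj e.
have /= ew := projT1_eq e; subst w'.
by case: (existT_inj e) => /IH -> ->.
Qed.

(** Paths are built from their start by adding arrows at the end, while the
    radical of P_x is governed by the first arrow. *)
Lemma qpath_uncons (x z : Q) (p : qpath x z) :
  qlen p = 0%N \/ exists y (a : arrow x y) (q : qpath y z), p = qcat (qarr a) q.
Proof.
elim: p => [|y {}z p [p0|[w [b [q ->]]]] a]; first by left.
  have e := qlen0 p0; have /= ey := projT1_eq e; subst y.
  right; exists z, a, (qpath_nil z); rewrite /qarr /=.
  by rewrite (existT_inj e).
by right; exists w, b, (qpath_snoc q a).
Qed.

Lemma qarr_cat_inj (x y y' z : Q) (a : arrow x y) (p : qpath y z)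
    (a' : arrow x y') (p' : qpath y' z) :
  qcat (qarr a) p = qcat (qarr a') p' ->
  existT (fun y => arrow x y) y a = existT _ y' a'.
Proof.
elim: p y' a' p' => [|w {}z p IH b] y' a' p' e;
  have := congr1 (@qlen x _) e; rewrite !qlen_cat /= => len.
  have e0 := qlen0 (esym (succn_inj len)); have /= ez := projT1_eq e0; subst y'.
  move: e; rewrite (existT_inj e0) /= => /qsnoc_inj e.
  by case: (existT_inj e) => ->.
have [p'0|[w' [q [b' E]]]] := qpath_case p'.
  by rewrite p'0 !add1n in len.
rewrite {}E in e; move: e => /= /qsnoc_inj e.
have /= ew := projT1_eq e; subst w'.
by case: (existT_inj e) => /IH ->.
Qed.

Section IntervalFinite.
Hypothesis Qi : interval_finite Q.

Lemma qlen_bounded (x y : Q) : exists N, forall p : qpath x y, (qlen p < N)%N.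
Proof.
exists (\max_(p : fqpath x y) qlen (qpath_of p : qpath x y)).+1 => p.
by have [p' <-] := qpath_of_surj p Qi; rewrite ltnS leq_bigmax.
Qed.

Fixpoint qpow (x : Q) (c : qpath x x) n : qpath x x :=
  if n is n'.+1 then qcat c (qpow c n') else qpath_nil x.

(** The powers of a nontrivial cycle would be paths from x to x of unbounded
    length. *)
Lemma no_cycle (x : Q) (c : qpath x x) : c = qpath_nil x.
Proof.
apply: qlen0_nil; apply/eqP; rewrite -leqn0 leqNgt; apply/negP => c0.
have [N HN] := qlen_bounded x x.
have : (N <= qlen (qpow c N))%N.
  elim: N {HN} => //= n IH; rewrite qlen_cat -add1n; exact: leq_add.
by rewrite leqNgt HN.
Qed.

Lemma ends_at_start_nil (x y : Q) (c : qpath x y) (d : qpath y x) : qlen c = 0%N.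
Proof.
have := congr1 (@qlen x x) (no_cycle (qcat c d)).
by rewrite qlen_cat /= => /eqP; rewrite addn_eq0 => /andP[/eqP].
Qed.

End IntervalFinite.

End Paths.

(** * The projectives P_x *)

Section PathAction.
Variables (k : fieldType) (Q : quiver).
Notation Rep := (representation k Q).
Implicit Types L M N P : Rep.

Fixpoint path_act M (x y : Q) (p : qpath x y) : 'Hom(M x, M y) :=
  match p in qpath _ y return 'Hom(M x, M y) with
  | qpath_nil => \1%VF
  | qpath_snoc _ _ p a => (rmap M a \o path_act M p)%VF
  end.

Lemma path_act_nil M (x : Q) (u : M x) : path_act M (qpath_nil x) u = u.
Proof. exact: id_lfunE. Qed.

Lemma path_act_snoc M (x y z : Q) (p : qpath x y) (a : arrow y z) (u : M x) :
  path_act M (qpath_snoc p a) u = rmap M a (path_act M p u).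
Proof. exact: comp_lfunE. Qed.

Lemma path_act_arr M (x y : Q) (a : arrow x y) (u : M x) :
  path_act M (qarr a) u = rmap M a u.
Proof. by rewrite path_act_snoc path_act_nil. Qed.

Lemma path_act_cat M (x y z : Q) (c : qpath x y) (p : qpath y z) (u : M x) :
  path_act M (qcat c p) u = path_act M p (path_act M c u).
Proof.
by elim: p => [|y' z' p IH a]; rewrite ?path_act_nil //= !comp_lfunE IH.
Qed.

Lemma rhom_path_act M N (f : M ~> N) (x y : Q) (p : qpath x y) u :
  rhom f y (path_act M p u) = path_act N p (rhom f x u).
Proof.
elim: p => [|y' z p IH a]; first by rewrite !path_act_nil.
by rewrite !path_act_snoc rhom_nat IH.
Qed.

End PathAction.

Section Projectives.
Variables (k : fieldType) (Q : quiver).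
Hypothesis Qi : interval_finite Q.
Notation Rep := (representation k Q).
Notation "''P_' x" := (projective k x : Rep) (at level 8, x at level 2).
Implicit Types L M N P : Rep.

Definition fqpath_of (x y : Q) (p : qpath x y) : fqpath x y := sval (cid (qpath_of_surj p Qi)).

Lemma fqpath_ofK (x y : Q) (p : qpath x y) : qpath_of (fqpath_of p) = p.
Proof. exact: svalP (cid (qpath_of_surj p Qi)). Qed.

Lemma qpath_ofK (x y : Q) (q : fqpath x y) : fqpath_of (qpath_of q) = q.
Proof. by apply: qpath_of_inj; rewrite fqpath_ofK. Qed.

Definition pcoef (x y : Q) (u : 'P_x y) (p : qpath x y) : k :=
  (u : {ffun fqpath x y -> k^o}) (fqpath_of p).

Definition pbas (x y : Q) (p : qpath x y) : 'P_x y :=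
  ([ffun q => (q == fqpath_of p)%:R] : {ffun fqpath x y -> k^o}).

Lemma pcoefP (x y : Q) (u v : 'P_x y) : (forall p, pcoef u p = pcoef v p) -> u = v.
Proof.
by move=> uv; apply/ffunP => q; have := uv (qpath_of q); rewrite /pcoef qpath_ofK.
Qed.

Lemma pcoefD (x y : Q) (u v : 'P_x y) p : pcoef (u + v) p = pcoef u p + pcoef v p.
Proof. exact: ffunE. Qed.

Lemma pcoefN (x y : Q) (u : 'P_x y) p : pcoef (- u) p = - pcoef u p.
Proof. exact: ffunE. Qed.

Lemma pcoef0 (x y : Q) p : pcoef (0 : 'P_x y) p = 0.
Proof. exact: ffunE. Qed.

Lemma pcoefZ (x y : Q) c (u : 'P_x y) p : pcoef (c *: u) p = c * pcoef u p.
Proof. exact: ffunE. Qed.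

Lemma pcoef_sum (x y : Q) (I : finType) (F : I -> 'P_x y) p :
  pcoef (\sum_i F i) p = \sum_i pcoef (F i) p.
Proof.
elim/big_rec2: _ => [|i a b _ <-]; first exact: pcoef0.
exact: pcoefD.
Qed.

Lemma pcoef_bas (x y : Q) (p q : qpath x y) : pcoef (pbas p) q = (`[< q = p >])%:R.
Proof.
rewrite /pcoef /pbas ffunE; congr (_%:R); congr nat_of_bool.
apply/eqP/asboolP => [|-> //] e.
by rewrite -(fqpath_ofK q) e fqpath_ofK.
Qed.

Lemma pexpand (x y : Q) (u : 'P_x y) :
  u = \sum_(q : fqpath x y) pcoef u (qpath_of q) *: pbas (qpath_of q).
Proof.
apply: pcoefP => p; rewrite pcoef_sum (bigD1 (fqpath_of p)) //= big1 ?addr0.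
  by rewrite pcoefZ pcoef_bas fqpath_ofK asboolT // mulr1.
move=> q qp; rewrite pcoefZ pcoef_bas asboolF ?mulr0 // => e.
by move: qp; rewrite e qpath_ofK eqxx.
Qed.

Lemma rmap_bas (x y z : Q) (a : arrow y z) (p : qpath x y) :
  rmap (projective k x) a (pbas p) = pbas (qpath_snoc p a).
Proof.
by rewrite /pbas; apply: projective_map_path; rewrite !fqpath_ofK.
Qed.

Definition pgen (x : Q) : 'P_x x := pbas (qpath_nil x).

Lemma path_act_bas (x y z : Q) (c : qpath x y) (p : qpath y z) :
  path_act (projective k x) p (pbas c) = pbas (qcat c p).
Proof.
elim: p => [|z' w p IH a]; first by rewrite path_act_nil.
by rewrite path_act_snoc IH rmap_bas.
Qed.

Lemma path_act_gen (x y : Q) (p : qpath x y) :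
  path_act (projective k x) p (pgen x) = pbas p.
Proof. by rewrite path_act_bas qcat_nil. Qed.

Section Yoneda.
Variables (x : Q) (M : Rep) (m : M x).

Definition yoneda_fun z (u : 'P_x z) : M z :=
  \sum_(q : fqpath x z) pcoef u (qpath_of q) *: path_act M (qpath_of q) m.

Fact yoneda_fun_linear z : linear (@yoneda_fun z).
Proof.
move=> c u v; rewrite /yoneda_fun scaler_sumr -big_split /=.
by apply: eq_bigr => q _; rewrite pcoefD pcoefZ scalerDl scalerA.
Qed.
HB.instance Definition _ z :=
  GRing.isLinear.Build k _ _ _ (@yoneda_fun z) (@yoneda_fun_linear z).

Lemma yoneda_fun_bas z (p : qpath x z) : yoneda_fun (pbas p) = path_act M p m.
Proof.
rewrite /yoneda_fun (bigD1 (fqpath_of p)) //= big1 ?addr0.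
  by rewrite pcoef_bas fqpath_ofK asboolT // scale1r.
move=> q qp; rewrite pcoef_bas asboolF ?scale0r // => e.
by move: qp; rewrite -e qpath_ofK eqxx.
Qed.

Fact yoneda_nat y z (a : arrow y z) :
  (linfun (@yoneda_fun z) \o rmap (projective k x) a)%VF =
  (rmap M a \o linfun (@yoneda_fun y))%VF.
Proof.
apply/lfunP => u; rewrite [u]pexpand !linear_sum; apply: eq_bigr => q _.
rewrite !linearZ; congr (_ *: _).
by rewrite [LHS]comp_lfunE [RHS]comp_lfunE rmap_bas !lfunE /= !yoneda_fun_bas path_act_snoc.
Qed.

Definition yoneda : 'P_x ~> M :=
  @RepHom k Q (projective k x) M (fun z => linfun (@yoneda_fun z)) yoneda_nat.

Lemma yoneda_bas z (p : qpath x z) : rhom yoneda z (pbas p) = path_act M p m.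
Proof. by rewrite /= lfunE /= yoneda_fun_bas. Qed.

Lemma yoneda_gen : rhom yoneda x (pgen x) = m.
Proof. by rewrite yoneda_bas path_act_nil. Qed.

Lemma yonedaE z (u : 'P_x z) :
  rhom yoneda z u = \sum_(q : fqpath x z) pcoef u (qpath_of q) *: path_act M (qpath_of q) m.
Proof. by rewrite /= lfunE. Qed.

End Yoneda.

Lemma projective_hom_eq (x : Q) M (f g : 'P_x ~> M) :
  rhom f x (pgen x) = rhom g x (pgen x) -> f = g.
Proof.
move=> fg; apply/rhom_eqP => z u; rewrite [u]pexpand !rhom_sum.
apply: eq_bigr => q _; rewrite !rhomZ; congr (_ *: _).
by rewrite -path_act_gen !rhom_path_act fg.
Qed.

Lemma projective_lift (x : Q) L M (p : L ~> M) (g : 'P_x ~> M) :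
  pw_surj p -> exists h, p ** h = g.
Proof.
move=> ps; have [m pm] := ps x (rhom g x (pgen x)).
exists (yoneda m); apply: projective_hom_eq; by rewrite rhomE yoneda_gen.
Qed.

Definition path_mor (x y : Q) (c : qpath x y) : 'P_y ~> 'P_x := yoneda (pbas c).

Lemma path_mor_bas (x y z : Q) (c : qpath x y) (p : qpath y z) :
  rhom (path_mor c) z (pbas p) = pbas (qcat c p).
Proof. by rewrite yoneda_bas path_act_bas. Qed.

Lemma path_mor_coef (x y z : Q) (c : qpath x y) (u : 'P_y z) (p : qpath y z) :
  pcoef (rhom (path_mor c) z u) (qcat c p) = pcoef u p.
Proof.
rewrite {1}[u]pexpand rhom_sum pcoef_sum (bigD1 (fqpath_of p)) // big1.
  by rewrite rhomZ pcoefZ path_mor_bas pcoef_bas fqpath_ofK asboolT //= addr0 mulr1.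
move=> q qp; rewrite rhomZ pcoefZ path_mor_bas pcoef_bas asboolF ?mulr0 //.
by move=> /qcat_inj e; move: qp; rewrite e qpath_ofK eqxx.
Qed.

Lemma path_mor_coef0 (x y z : Q) (c : qpath x y) (u : 'P_y z) (q : qpath x z) :
  (forall p, q <> qcat c p) -> pcoef (rhom (path_mor c) z u) q = 0.
Proof.
move=> qc; rewrite {1}[u]pexpand rhom_sum pcoef_sum big1 // => p _.
by rewrite rhomZ pcoefZ path_mor_bas pcoef_bas asboolF ?mulr0.
Qed.

Lemma path_mor_inj (x y : Q) (c : qpath x y) : pw_inj (path_mor c).
Proof.
move=> z u u0; apply: pcoefP => p.
by rewrite -(path_mor_coef c) u0 !pcoef0.
Qed.

Lemma path_mor_comp (x y z : Q) (c : qpath x y) (d : qpath y z) :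
  path_mor c ** path_mor d = path_mor (qcat c d).
Proof.
by apply: projective_hom_eq; rewrite rhomE !path_mor_bas.
Qed.

Lemma path_mor_neq0 (x y : Q) (c : qpath x y) : path_mor c <> 0.
Proof.
move=> /rhom_eqP/(_ y (pgen y)); rewrite yoneda_gen rhom0.
move=> /(congr1 (fun u => pcoef u c)); rewrite pcoef_bas asboolT // pcoef0.
by move/eqP; rewrite oner_eq0.
Qed.

Lemma projective_eq0 (x y : Q) (u : 'P_x y) : (qpath x y -> False) -> u = 0.
Proof. by move=> H; apply: pcoefP => p; case: (H p). Qed.

Definition rep_scale M N (c : k) (f : M ~> N) : M ~> N :=
  @RepHom k Q M N (fun x => c *: rhom f x)
    (fun x y a => etrans (esym (comp_lfunZl _ _ _))
       (etrans (congr1 ( *:%R c) (rhomP f a)) (comp_lfunZr _ _ _))).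

Lemma rep_scaleE M N (c : k) (f : M ~> N) x u :
  rhom (rep_scale c f) x u = c *: rhom f x u.
Proof. exact: scale_lfunE. Qed.

(** The trivial path is the only path from x to x, so it is mapped to a multiple
    of itself. *)
Lemma endo_projective (x : Q) (f : 'P_x ~> 'P_x) :
  exists c, f = rep_scale c (idm (projective k x)).
Proof.
exists (pcoef (rhom f x (pgen x)) (qpath_nil x)).
apply: projective_hom_eq; rewrite rep_scaleE rhom_id.
apply: pcoefP => p; rewrite (no_cycle Qi p) pcoefZ pcoef_bas asboolT //.
by rewrite mulr1.
Qed.

Lemma endo_projective_comp0 (x : Q) M (f : 'P_x ~> 'P_x) (g : M ~> 'P_x) :
  g <> 0 -> f ** g = 0 -> f = 0.
Proof.
have [c ->] := endo_projective f => g0 fg0.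
have /eqP c0 : c == 0.
  apply: contra_notT g0 => c0; apply/rhom_eqP => x' u.
  have /rhom_eqP/(_ x' u) := fg0; rewrite rhomE rep_scaleE !rhomE => /eqP.
  by rewrite scaler_eq0 (negPf c0) => /eqP.
by apply/rhom_eqP => x' u; rewrite rep_scaleE c0 scale0r rhom0.
Qed.

End Projectives.

(** * Finitely generated representations *)

(** Dividing by the first nonzero coefficient expresses the lowest power of x by
    higher ones. The factor [x ^+ j] keeps track of the vanishing coefficients
    already passed. *)
Lemma pi_regular_of_relation (R : pzRingType) (x : R) n (c : nat -> R) j :
    (forall i, GRing.comm x (c i)) ->
    (forall i, c i = 0 \/ exists d, c i * d = 1 /\ GRing.comm x d) ->
    (exists2 i, (i < n)%N & c i <> 0) ->
    x ^+ j * (\sum_(i < n) x ^+ i * c i) = 0 ->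
  exists m y, GRing.comm x y /\ x ^+ m = x ^+ m.+1 * y.
Proof.
elim: n c j => [|n IH] c j cx cu [i in0 ci0]; first by [].
rewrite big_ord_recl expr0 mul1r.
have -> : \sum_(i < n) x ^+ lift ord0 i * c (lift ord0 i) =
          x * \sum_(i < n) x ^+ i * c i.+1.
  by rewrite mulr_sumr; apply: eq_bigr => l _; rewrite exprS mulrA.
set E := \sum_(i < n) _.
have xE : GRing.comm x E.
  by apply: commr_sum => l _; apply: commrM; [apply: commrX | apply: cx].
case: (cu 0%N) => [c0 | [d [cd xd]]].
  rewrite c0 add0r mulrA -exprSr => rel.
  apply: (IH (fun i => c i.+1) j.+1) => //.
  case: i in0 ci0 => [|i] in0 ci0; first by case: (ci0 c0).
  exact: (ex_intro2 _ _ i in0 ci0).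
rewrite mulrDr mulrA -exprSr => /eqP; rewrite addr_eq0 => /eqP rel.
exists j, (- (E * d)); split; first by apply/commrN/commrM.
by rewrite mulrN mulrA -mulNr -rel -mulrA cd mulr1.
Qed.

(** A subspace of largest dimension among those contained in I exhausts I. *)
Lemma pred_vspace (k : fieldType) (W : vectType k) (I : W -> Prop) :
  I 0 -> (forall c u v, I u -> I v -> I (c *: u + v)) ->
  exists U : {vspace W}, forall w, w \in U <-> I w.
Proof.
move=> I0 Ilin.
pose P n := `[< exists2 U : {vspace W}, (forall w, w \in U -> I w) & \dim U = n >].
have exP : exists n, P n.
  exists 0%N; apply/asboolP; exists 0%VS; last exact: dimv0.
  by move=> w; rewrite memv0 => /eqP ->.
have bP n : P n -> (n <= \dim {:W})%N.
  by move=> /asboolP[U _ <-]; apply/dimvS/subvf.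
case: (ex_maxnP exP bP) => n /asboolP[U UI dU] maxn.
exists U => w; split=> [|Iw]; first exact: UI.
have : P (\dim (<[w]> + U)%VS).
  apply/asboolP; exists (<[w]> + U)%VS => // v /memv_addP[a /vlineP[c ->] [b bU ->]].
  exact/Ilin/UI.
move/maxn; rewrite -dU => le.
have /eqP -> : U == (<[w]> + U)%VS by rewrite eqEdim addvSr.
by rewrite (subvP (addvSl _ _)) ?memv_line.
Qed.

Section HomSpace.
Variables (k : fieldType) (Q : quiver).
Notation Rep := (representation k Q).
Notation vtx := {classic Q}.
Implicit Types L M N P : Rep.

(** Values of a morphism at finitely many vertices. When these vertices generate
    M, recording the values is injective, which makes the group of morphisms
    M -> N finite-dimensional. *)
Fixpoint hom_space M N (s : seq vtx) : vectType k :=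
  if s is x :: s' then ('Hom(M x, N x) * hom_space M N s')%type else 'rV[k]_0.

Fixpoint hom_eval M N (s : seq vtx) (f : M ~> N) : hom_space M N s :=
  match s return hom_space M N s with
  | [::] => 0
  | x :: s' => (rhom f x, hom_eval s' f)
  end.

Lemma hom_evalD M N s (f g : M ~> N) : hom_eval s (f + g) = hom_eval s f + hom_eval s g.
Proof. by elim: s => [|x s IH] /=; rewrite ?addr0 // IH. Qed.

Lemma hom_eval0 M N s : hom_eval s (0 : M ~> N) = 0.
Proof. by elim: s => //= x s ->. Qed.

Lemma hom_evalZ M N s c (f : M ~> N) : hom_eval s (rep_scale c f) = c *: hom_eval s f.
Proof. by elim: s => [|x s IH] /=; rewrite ?scaler0 // IH. Qed.

Lemma hom_eval_sum M N s (I : finType) (F : I -> M ~> N) :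
  hom_eval s (\sum_i F i) = \sum_i hom_eval s (F i).
Proof.
elim/big_rec2: _ => [|i a b _ <-]; first exact: hom_eval0.
exact: hom_evalD.
Qed.

Lemma hom_eval_eq0 M N s (f : M ~> N) x u : hom_eval s f = 0 -> x \in s -> rhom f x u = 0.
Proof.
elim: s => //= y s IH [fy fs]; rewrite in_cons => /orP[/eqP xy |]; last exact: IH.
by rewrite -xy in fy; rewrite fy zero_lfunE.
Qed.

(** Generation is phrased through morphisms out of M, so that it passes to direct
    sums, summands and quotients by formal arguments. *)
Definition generated_by (s : seq vtx) M :=
  forall N (u : M ~> N), (forall x, x \in s -> forall v, rhom u x v = 0) -> u = 0.

Lemma generated_by_hom_eval s M N (f : M ~> N) : generated_by s M -> hom_eval s f = 0 -> f = 0.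
Proof. by move=> gen f0; apply: gen => x xs v; apply: hom_eval_eq0 xs. Qed.

Lemma generated_by_epi s L M (p : L ~> M) :
  pw_surj p -> generated_by s L -> generated_by s M.
Proof.
move=> ps gen N u us; apply: (pw_surj_cancel ps); rewrite comp0m; apply: gen => x xs v.
by rewrite rhomE us.
Qed.

Definition fin_gen (M : rep k Q) := exists s, generated_by s M.

Lemma generated_by_projective (x : Q) :
  interval_finite Q -> generated_by [:: x] (projective k x).
Proof.
move=> Qi N u us; apply: (@projective_hom_eq k Q Qi x N).
by rewrite us ?mem_head // rhom0.
Qed.

Lemma fin_gen_subcategory : subcategory fin_gen.
Proof.
split=> [M M0 | M N S [i1 [i2 [p1 [p2 [a b c d E]]]]] [s gM] [t gN] |
         M N S [i1 [i2 [p1 [p2 [a b c d E]]]]] [s gS]].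
- by exists [::] => N u _; rewrite -[u]compm1 M0 compm0.
- exists (s ++ t) => L u us.
  have u1 : u ** i1 = 0.
    by apply: gM => x xs v; rewrite rhomE us // mem_cat xs.
  have u2 : u ** i2 = 0.
    by apply: gN => x xs v; rewrite rhomE us // mem_cat xs orbT.
  by rewrite -[u]compm1 -E compDr !compmA u1 u2 !comp0m addr0.
- split; exists s.
    apply: (@generated_by_epi s S M p1 _ gS); apply: split_epi_pw_surj; by exists i1.
  apply: (@generated_by_epi s S N p2 _ gS); apply: split_epi_pw_surj; by exists i2.
Qed.

Lemma rep_scale_comm M (c : k) (f : M ~> M) :
  rep_scale c (idm (M : rep k Q)) ** f = f ** rep_scale c (idm (M : rep k Q)).
Proof. by apply/rhom_eqP => x u; rewrite !rhomE !rep_scaleE !rhomE rhomZ. Qed.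

(** At the vertices of a finite generating set the powers of x are linearly
    dependent, and a relation that holds there holds everywhere. *)
Lemma fin_gen_pi_regular M (x : @endo (rep k Q) M) : fin_gen M ->
  exists (m : nat) (y : @endo (rep k Q) M), GRing.comm x y /\ x ^+ m = x ^+ m.+1 * y.
Proof.
move=> [s gen].
case: (pselect (idm (M : rep k Q) = 0)) => [M0 | M0].
  exists 0%N, 0; split; first exact: commr0.
  by rewrite mulr0; apply: M0.
pose W := hom_space M M s; pose n := (\dim {:W}).+1.
pose X := [tuple hom_eval s (x ^+ i : M ~> M) | i < n].
have /freeP X0 : ~~ free X.
  by rewrite /free size_tuple neq_ltn ltnS dimvS ?subvf.
pose scal c : @endo (rep k Q) M := rep_scale c (idm (M : rep k Q)).
have scalC c : GRing.comm x (scal c) by apply/esym/rep_scale_comm.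
have /existsNP[c /not_implyP[cX /existsNP[i ci]]] :
    ~ forall c : 'I_n -> k, \sum_(i < n) c i *: X`_i = 0 -> forall i, c i = 0.
  by move=> H; apply: X0; exact: H.
pose c' j := if insub j is Some j' then scal (c j') else 0.
have c'E (j : 'I_n) : c' j = scal (c j) by rewrite /c' valK.
have scal_mul a b : scal a * scal b = scal (a * b).
  by apply/rhom_eqP => z u; rewrite rhomE !rep_scaleE !rhomE scalerA.
have scal1 : scal 1 = 1.
  by apply/rhom_eqP => z u; rewrite !rep_scaleE !rhomE scale1r.
apply: (@pi_regular_of_relation _ x n c' 0).
- by move=> j; rewrite /c'; case: insubP => [j' _ _|_] //; apply: commr0.
- move=> j; rewrite /c'; case: insubP => [j' _ _|_]; last by left.
  have [->|cj] := eqVneq (c j') 0.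
    by left; apply/rhom_eqP => z u; rewrite rep_scaleE scale0r rhom0.
  right; exists (scal (c j')^-1); split; last exact: scalC.
  by rewrite scal_mul divff.
- exists (i : nat); first exact: ltn_ord.
  rewrite c'E => ci0; apply: M0; have /eqP cin : c i <> 0 by [].
  by rewrite -[LHS]/(1 : @endo (rep k Q) M) -scal1 -(mulVf cin) -scal_mul ci0 mulr0.
rewrite expr0 mul1r; apply: (generated_by_hom_eval gen).
rewrite -[RHS]cX hom_eval_sum; apply: eq_bigr => j _.
rewrite c'E (nth_map j) ?size_enum_ord // nth_ord_enum -hom_evalZ; congr hom_eval.
apply/rhom_eqP => z u; rewrite rhomE !rep_scaleE rhomE.
by rewrite rhomZ.
Qed.

End HomSpace.

(** * Finitely presented representations *)

Section FinitelyPresented.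
Variables (k : fieldType) (Q : quiver).
Hypothesis Qi : interval_finite Q.
Notation Rep := (representation k Q).
Notation vtx := {classic Q}.
Notation "''P_' x" := (projective k x : Rep) (at level 8, x at level 2).
Implicit Types L M N P : Rep.

Lemma proj_rep_subcategory : subcategory (@proj_rep k Q).
Proof. exact: generated_subcategory_subcategory. Qed.

Lemma proj_rep_projective (x : Q) : proj_rep (projective k x).
Proof. by move=> D _; apply; exists x. Qed.

(** The lifting property holds for P_x by evaluation at the trivial path, and is
    inherited by sums and summands. *)
Lemma proj_rep_lift P L M (p : L ~> M) (g : P ~> M) :
  proj_rep P -> pw_surj p -> exists h, p ** h = g.
Proof.
move=> PP ps.
pose D (P : rep k Q) := forall g : mor P (M : rep k Q), exists h, p ** h = g.
suff /(_ g) : D P by [].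
apply: PP => [|Y [x ->] f]; last exact: projective_lift.
split=> [X X0 f | X Y S [i1 [i2 [p1 [p2 [a b c d E]]]]] DX DY f |
         X Y S [i1 [i2 [p1 [p2 [a b c d E]]]]] DS].
- by exists 0; rewrite compm0 -[f]compm1 X0 compm0.
- have [h1 e1] := DX (f ** i1); have [h2 e2] := DY (f ** i2).
  exists (h1 ** p1 + h2 ** p2).
  by rewrite compDr !compmA e1 e2 -!compmA -compDr E compm1.
- split=> f.
    have [h e] := DS (f ** p1); exists (h ** i1).
    by rewrite compmA e -compmA a compm1.
  have [h e] := DS (f ** p2); exists (h ** i2).
  by rewrite compmA e -compmA b compm1.
Qed.

Lemma proj_rep_fin_gen P : proj_rep P -> fin_gen P.
Proof.
apply; first exact: fin_gen_subcategory.
by move=> _ [x ->]; exists [:: x]; apply: generated_by_projective.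
Qed.

Lemma zero_rep_exists : exists Z : Rep, is_zero (Z : rep k Q).
Proof.
exists (@Representation k Q (fun _ => 'rV[k]_0 : vectType k) (fun _ _ _ => 0)).
by apply/rhom_eqP => x u; rewrite rhomE [u]thinmx0 linear0.
Qed.

Lemma proj_rep_sum P P' : proj_rep P -> proj_rep P' ->
  exists S, is_direct_sum (P : rep k Q) P' S /\ proj_rep S.
Proof.
move=> PP PP'; have [S dS] := direct_sum_exists P P'; exists S; split=> //.
have [_ D _] := proj_rep_subcategory; exact: D dS PP PP'.
Qed.

Lemma fp_intro P1 P0 M (i : P1 ~> P0) (p : P0 ~> M) :
  proj_rep P1 -> proj_rep P0 -> pw_inj i -> pw_surj p -> pw_exact p i ->
  finitely_presented M.
Proof.
by move=> ? ? ii ps ex; exists P1, P0, i, p; split=> //; apply: pw_short_exact.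
Qed.

Lemma fp_elim M : finitely_presented M ->
  exists P1 P0 (i : P1 ~> P0) (p : P0 ~> M),
    [/\ proj_rep P1, proj_rep P0, pw_inj i, pw_surj p & pw_exact p i].
Proof.
move=> [P1 [P0 [i [p [h1 h0 /short_exact_pw[? ? ?]]]]]].
by exists P1, P0, i, p.
Qed.

Lemma fp_fin_gen M : finitely_presented M -> fin_gen M.
Proof.
move=> /fp_elim[P1 [P0 [i [p [_ /proj_rep_fin_gen[s gs] _ ps _]]]]].
by exists s; apply: generated_by_epi gs.
Qed.

Lemma proj_rep_fp P : proj_rep P -> finitely_presented P.
Proof.
move=> PP; have [Z Z0] := zero_rep_exists.
have [D0 _ _] := proj_rep_subcategory.
apply: (@fp_intro Z P P 0 (idm (P : rep k Q))) => // [|x u _|x u|x u].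
- exact: D0.
- have /rhom_eqP/(_ x u) := Z0; by rewrite !rhomE.
- by exists u; rewrite rhomE.
- rewrite rhomE; split=> [-> | [w <-]]; last by rewrite rhomE.
  by exists 0; rewrite linear0.
Qed.

(** Schanuel's trick. Let e lift to P0 the projection of M onto the summand
    complementary to N, and let K be the kernel of P0 -> N. The maps
    p |-> (p - e p, p) and (a, b) |-> a + e b exhibit K as a retract of
    P1 + P0, whence K is projective. *)
Lemma fp_retract M N (j : N ~> M) (r : M ~> N) :
  finitely_presented M -> r ** j = idm (N : rep k Q) -> finitely_presented N.
Proof.
move=> /fp_elim[P1 [P0 [i [p [PP1 PP0 ii ps ex]]]]] rj.
have [e pe] := @proj_rep_lift P0 P0 M p ((idm (M : rep k Q) - j ** r) ** p) PP0 ps.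
have rps : pw_surj (r ** p).
  move=> x v; have [w e'] := ps x (rhom j x v); exists w.
  by rewrite rhomE e' -rhom_comp rj rhomE.
have [K [kk [ki kex]]] := kernel_exists (r ** p).
have [S [[i1 [i2 [p1 [p2 [a b c d E]]]]] PS]] := proj_rep_sum PP1 PP0.
have rpk : r ** p ** kk = 0 by apply: pw_exact_comp0 kex.
have [u iu] : exists u : K ~> P1, i ** u = kk - e ** kk.
  apply: (lift_kernel ii ex).
  rewrite compBr compmA pe compBl comp1m compBl -!compmA.
  by rewrite (compmA r) rpk compm0 subr0 subrr.
have [v kv] : exists v : S ~> K, kk ** v = i ** p1 + e ** p2.
  apply: (lift_kernel ki kex).
  rewrite compDr -!compmA (compmA p i) (pw_exact_comp0 ex) comp0m compm0 add0r.
  have re : r ** (idm (M : rep k Q) - j ** r) = 0.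
    by rewrite compBr compm1 compmA rj comp1m subrr.
  by rewrite (compmA p e) pe -!compmA (compmA r) re comp0m.
have PK : proj_rep K.
  apply: (@subcategory_retract _ _ S K (i1 ** u + i2 ** kk) v) PS => //.
  - exact: rep_idempotents_split.
  - exact: proj_rep_subcategory.
  apply: (pw_inj_cancel ki); rewrite compmA kv compDl !compDr -!compmA.
  rewrite !(compmA p1) !(compmA p2) a b c d !comp1m !comp0m !compm0 addr0 add0r.
  by rewrite iu subrK compm1.
exact: (fp_intro PK PP0 ki rps kex).
Qed.

Lemma rep_plus_idempotents_split : idempotents_split (rep_plus k Q).
Proof.
move=> [M Mfp] e ee.
have [N [i [p [pi ip]]]] := @rep_idempotents_split k Q M e ee.
by exists (exist _ N (fp_retract Mfp pi)), i, p.
Qed.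

Lemma rep_plus_local (X : rep_plus k Q) : indecomposable X -> local_endo X.
Proof.
move=> indX; apply: pi_regular_local => //; first exact: rep_plus_idempotents_split.
case: X {indX} => M Mfp x.
have [m [y [cxy e]]] := @fin_gen_pi_regular k Q M x (fp_fin_gen Mfp).
by exists m, y.
Qed.

(** If g factors on both summands of a decomposition of Z, then it factors. So
    the failure passes to a summand, whose total dimension at the vertices of
    a generating set of Z is smaller. *)
Lemma indecomposable_retract (X Y : rep_plus k Q) (f : mor X Y)
    (Z : rep_plus k Q) (g : mor Z Y) :
  ~ factors_through g f ->
  exists (Z' : rep_plus k Q) (i : mor Z' Z) (p : mor Z Z'),
    [/\ indecomposable Z', p ** i = idm Z' & ~ factors_through (g ** i) f].
Proof.
have [s gs] := fp_fin_gen (svalP Z).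
pose mu (W : rep_plus k Q) := \sum_(x <- s) \dim {: (sval W : Rep) x}.
move: {2}(mu Z) (leqnn (mu Z)) => n.
elim: n Z g gs => [|n IH] Z g gs muZ nf.
  case: nf; have -> : g = 0; last exact: factors_through0.
  apply: gs => x xs v; have : (\dim {: (sval Z : Rep) x} <= 0)%N.
    by rewrite (leq_trans _ muZ) // /mu (big_rem x) //= leq_addr.
  rewrite leqn0 dimv_eq0 => /eqP z0.
  have : v \in {: (sval Z : Rep) x}%VS by rewrite memvf.
  by rewrite z0 memv0 => /eqP ->; rewrite linear0.
case: (pselect (indecomposable Z)) => [indZ | nind].
  by exists Z, (idm Z), (idm Z); split; rewrite ?comp1m ?compm1.
have Z0 : ~ is_zero Z.
  by move=> Z0; apply: nf; rewrite -[g]compm1 Z0 compm0; apply: factors_through0.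
have /existsNP[Y1 /existsNP[Y2 /not_implyP[dsum /not_orP[nY1 nY2]]]] :
  ~ forall Y Z', is_direct_sum Y Z' Z -> is_zero Y \/ is_zero Z' by move=> H; apply: nind.
have descend (A B : rep_plus k Q) i1 i2 p1 p2 : ~ is_zero B ->
    [/\ p1 ** i1 = idm A, p2 ** i2 = idm B, p1 ** i2 = 0, p2 ** i1 = 0
      & i1 ** p1 + i2 ** p2 = idm Z] -> ~ factors_through (g ** i1) f ->
    exists (Z' : rep_plus k Q) (i : mor Z' Z) (p : mor Z Z'),
    [/\ indecomposable Z', p ** i = idm Z' & ~ factors_through (g ** i) f].
  move=> B0 [a b c d E] nfA.
  have i1i : @pw_inj k Q (sval A) (sval Z) i1 by apply: split_mono_pw_inj; exists p1.
  have gA : generated_by s (sval A).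
    by apply: generated_by_epi gs; apply: (@split_epi_pw_surj k Q _ _ p1); exists i1.
  have gB : generated_by s (sval B).
    by apply: generated_by_epi gs; apply: (@split_epi_pw_surj k Q _ _ p2); exists i2.
  have leA x : (\dim {: (sval A : Rep) x} <= \dim {: (sval Z : Rep) x})%N by apply: pw_inj_dim i1i.
  have [|Z' [i [p [indZ' pi nfi]]]] := IH A (g ** i1) gA _ nfA.
    rewrite -ltnS (leq_trans _ muZ) // ltnNge; apply/negP => le.
    apply: B0; apply: gB => x xs v.
    have eqx : (\dim {: (sval Z : Rep) x} <= \dim {: (sval A : Rep) x})%N.
      move: le; rewrite /mu !(big_rem x xs) /= => le.
      have le' : (\sum_(y <- rem (x : vtx) s) \dim {: (sval A : Rep) y} <=
                  \sum_(y <- rem (x : vtx) s) \dim {: (sval Z : Rep) y})%N.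
        by apply: leq_sum => y _; apply: leA.
      by rewrite -(leq_add2r (\sum_(y <- rem (x : vtx) s) \dim {: (sval A : Rep) y}))
         (leq_trans _ le) // leq_add2l.
    have i1f : limg (@rhom k Q (sval A) (sval Z) i1 x) = fullv.
      apply/eqP; rewrite eqEdim subvf /= limg_dim_eq //.
      by rewrite (eqP (pw_inj_lker x i1i)) capv0.
    have /memv_imgP[w _ ew] : @rhom k Q (sval B) (sval Z) i2 x v \in
      limg (@rhom k Q (sval A) (sval Z) i1 x) by rewrite i1f memvf.
    have /rhom_eqP/(_ x v) := b; rewrite rhom_comp ew -rhom_comp => <-.
    have /rhom_eqP/(_ x w) dw := d; exact: etrans dw (zero_lfunE _ _).
  exists Z', (i1 ** i), (p ** p1); split=> //; last by rewrite compmA.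
  by rewrite -compmA (compmA p1) a comp1m.
have [i1 [i2 [p1 [p2 H]]]] := dsum.
have [a b c d E] := H.
case: (pselect (factors_through (g ** i1) f)) => [f1|]; last exact: descend H.
apply: (descend _ _ i2 i1 p2 p1 nY1); first by split=> //; rewrite addrC.
move=> f2; apply: nf; rewrite -[g]compm1 -E compDr !compmA.
by apply: factors_throughD; apply: factors_through_comp.
Qed.

End FinitelyPresented.

(** * Left almost split morphisms along a right infinite path *)

Section RightInfinitePath.
Variables (k : fieldType) (Q : quiver).
Hypothesis Qi : interval_finite Q.
Variables (v : nat -> Q) (a : forall n, arrow (v n) (v n.+1)).
Notation Rep := (representation k Q).
Notation vtx := {classic Q}.
Notation "''P_' x" := (projective k x : Rep) (at level 8, x at level 2).
Implicit Types L M P : Rep.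

Fixpoint ray n : qpath (v 0) (v n) :=
  if n is n'.+1 then qpath_snoc (ray n') (a n') else qpath_nil (v 0).

(** The ray without its first arrow; composition with it embeds P_(v n.+1) into P_(v 1). *)
Fixpoint ray1 n : qpath (v 1) (v n.+1) :=
  if n is n'.+1 then qpath_snoc (ray1 n') (a n'.+1) else qpath_nil (v 1).

Lemma ray_ray1 n : ray n.+1 = qcat (ray 1) (ray1 n).
Proof. by elim: n => // n IH; rewrite [LHS]/= -/(ray n.+1) IH. Qed.

Lemma qlen_ray n : qlen (ray n) = n.
Proof. by elim: n => //= n ->. Qed.

(** The lengths of the paths from v 0 to y are bounded, and a path from v n to y
    extends to one from v 0 of length at least n. *)
Lemma ray_escapes (s : seq vtx) :
  exists N, forall n, (N <= n)%N -> forall y : Q, (y : vtx) \in s -> qpath (v n) y -> False.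
Proof.
elim: s => [|x s [N HN]]; first by exists 0%N.
have [N' HN'] := qlen_bounded Qi (v 0) x.
exists (maxn N N') => n; rewrite geq_max => /andP[Nn N'n] y.
rewrite in_cons => /orP[/eqP yx p|]; last exact: HN.
rewrite yx in p.
have := HN' (qcat (ray n) p); rewrite qlen_cat qlen_ray.
by rewrite ltnNge (leq_trans N'n) // leq_addr.
Qed.

Lemma hom_to_ray_eq0 M : fin_gen M ->
  exists N, forall n, (N <= n)%N -> forall u : M ~> 'P_(v n), u = 0.
Proof.
move=> [s gen]; have [N HN] := ray_escapes s; exists N => n /HN esc u.
apply: gen => x xs w; apply: (projective_eq0 Qi); exact: esc.
Qed.

Definition ray_mor n : 'P_(v n) ~> 'P_(v 0) := path_mor k Qi (ray n).
Definition ray1_mor n : 'P_(v n.+1) ~> 'P_(v 1) := path_mor k Qi (ray1 n).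

Lemma ray_mor_ray1 n : ray_mor 1 ** ray1_mor n = ray_mor n.+1.
Proof. by rewrite /ray_mor /ray1_mor path_mor_comp -ray_ray1. Qed.

Definition ray_quot n : Rep := projT1 (cid (cokernel_exists (ray_mor n))).
Definition ray_proj n : 'P_(v 0) ~> ray_quot n :=
  projT1 (cid (projT2 (cid (cokernel_exists (ray_mor n))))).

Lemma ray_proj_surj n : pw_surj (ray_proj n).
Proof. by have [] := projT2 (cid (projT2 (cid (cokernel_exists (ray_mor n))))). Qed.

Lemma ray_proj_exact n : pw_exact (ray_proj n) (ray_mor n).
Proof. by have [] := projT2 (cid (projT2 (cid (cokernel_exists (ray_mor n))))). Qed.

Lemma ray_mor_inj n : pw_inj (ray_mor n).
Proof. exact: path_mor_inj. Qed.

Lemma ray_proj_mor n : ray_proj n ** ray_mor n = 0.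
Proof. exact: pw_exact_comp0 (ray_proj_exact n). Qed.

Lemma ray_quot_fp n : finitely_presented (ray_quot n).
Proof.
exact: (fp_intro (@proj_rep_projective k Q (v n)) (@proj_rep_projective k Q (v 0))
  (@ray_mor_inj n) (@ray_proj_surj n) (@ray_proj_exact n)).
Qed.

(** Lift the morphism on the generators P0 of M. The obstruction on the relations
    P1 is a morphism P1 -> P_(v n), which vanishes for n large. *)
Lemma lift_ray_quot M : finitely_presented M ->
  exists N, forall n, (N <= n)%N -> forall h : M ~> ray_quot n,
    exists h', ray_proj n ** h' = h.
Proof.
move=> /fp_elim[P1 [P0 [i [p [PP1 PP0 ii ps ex]]]]].
have [N0 H0] := hom_to_ray_eq0 (proj_rep_fin_gen Qi PP1).
exists N0 => n /H0{}H0 h.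
have [H qH] := proj_rep_lift Qi (h ** p) PP0 (@ray_proj_surj n).
have [w kw] : exists w, ray_mor n ** w = H ** i.
  apply: (lift_kernel (@ray_mor_inj n) (@ray_proj_exact n)).
  by rewrite compmA qH -compmA (pw_exact_comp0 ex) compm0.
have [|h' h'p] := @desc_cokernel k Q _ _ _ _ i p H ps ex.
  by rewrite -kw (H0 w) compm0.
by exists h'; apply: (pw_surj_cancel ps); rewrite -compmA h'p.
Qed.

Definition ray_projective : rep_plus k Q :=
  exist _ (projective k (v 0)) (proj_rep_fp (@proj_rep_projective k Q (v 0))).

Lemma ray_projective_neq0 : ~ is_zero ray_projective.
Proof.
move=> /(@rhom_eqP k Q ('P_(v 0)) ('P_(v 0)))/(_ (v 0) (pgen k Qi (v 0))).
rewrite rhom_id => /(congr1 (fun u => pcoef Qi u (qpath_nil (v 0)))).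
rewrite pcoef_bas asboolT // rhom0 pcoef0 => /eqP.
by rewrite oner_eq0.
Qed.

Lemma ray_projective_indecomposable : indecomposable ray_projective.
Proof.
split=> [|Y Z [i1 [i2 [p1 [p2 [h1 h2 h3 h4 E]]]]]]; first exact: ray_projective_neq0.
have [c cE] := @endo_projective k Q Qi (v 0) (i1 ** p1).
have ee : (i1 ** p1) ** (i1 ** p1) = i1 ** p1.
  by rewrite compmA -(compmA i1) h1 compm1.
have cc : c * c = c.
  have ec : rhom (i1 ** p1 : 'P_(v 0) ~> 'P_(v 0)) (v 0) (pgen k Qi (v 0)) =
    c *: pgen k Qi (v 0) by rewrite cE rep_scaleE rhom_id.
  have := congr1 (fun u => pcoef Qi (rhom (u : 'P_(v 0) ~> 'P_(v 0)) (v 0) (pgen k Qi (v 0)))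
    (qpath_nil (v 0))) ee.
  rewrite (@rhom_comp k Q ('P_(v 0)) ('P_(v 0)) ('P_(v 0)) (i1 ** p1) (i1 ** p1)).
  by rewrite ec rhomZ ec !pcoefZ pcoef_bas asboolT // !mulr1.
have : c * (c - 1) = 0 by rewrite mulrBr cc mulr1 subrr.
move=> /eqP; rewrite mulf_eq0 subr_eq0 => /orP[/eqP c0 | /eqP c1].
  left; have e0 : i1 ** p1 = 0.
    rewrite cE; apply: (@rhom_eqP k Q ('P_(v 0)) ('P_(v 0)) _ _).1 => x u.
    by rewrite rep_scaleE c0 scale0r rhom0.
  have h11 : idm Y = p1 ** (i1 ** p1) ** i1 by rewrite compmA h1 comp1m h1.
  by rewrite /is_zero h11 e0 compm0 comp0m.
right; have e1 : i1 ** p1 = idm ray_projective.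
  rewrite cE; apply: (@rhom_eqP k Q ('P_(v 0)) ('P_(v 0)) _ _).1 => x u.
  by rewrite rep_scaleE c1 scale1r.
by rewrite /is_zero -h2 -[p2]compm1 -e1 compmA h4 !comp0m.
Qed.

Lemma ray_proj_not_split_mono n : ~ split_mono (ray_proj n).
Proof.
move=> [r rq]; apply: (@path_mor_neq0 k Q Qi _ _ (ray n)).
by rewrite -[LHS]comp1m -rq -compmA ray_proj_mor compm0.
Qed.

(** The projection of P_(v 0) onto its quotient by P_(v n) is not a section, so
    it factors through g. For n large this factorization lifts to P_(v 0),
    where it is a retraction of g. *)
Lemma no_left_almost_split (B : rep_plus k Q) (g : mor ray_projective B) :
  ~ left_almost_split g.
Proof.
move=> [nsm las]; apply: nsm.
have [N HN] := lift_ray_quot (svalP B).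
have [N' HN'] := hom_to_ray_eq0 (proj_rep_fin_gen Qi (@proj_rep_projective k Q (v 0))).
pose n := maxn N N'.
pose X : rep_plus k Q := exist _ (ray_quot n) (ray_quot_fp n).
have [h hg] := las X (ray_proj n) (@ray_proj_not_split_mono n).
have [h' qh'] := HN n (leq_maxl _ _) h.
exists h'.
have [w kw] : exists w, ray_mor n ** w = (h' : sval B ~> 'P_(v 0)) ** g - idm (projective k (v 0)).
  apply: (lift_kernel (@ray_mor_inj n) (@ray_proj_exact n)).
  rewrite compBr compm1 compmA qh'; apply/eqP; rewrite subr_eq0; apply/eqP; exact: hg.
by apply/eqP; rewrite -subr_eq0; apply/eqP; rewrite -[LHS]kw (HN' n (leq_maxr _ _) w) compm0.
Qed.

Lemma infinite_path_not_left_AR : ~ left_Auslander_Reiten (rep_plus k Q).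
Proof.
move=> /(_ _ ray_projective_indecomposable)[[B [g [[_ las] _]]]|[B [Z [s [t [_ las _]]]]]];
  exact: no_left_almost_split las.
Qed.

End RightInfinitePath.

(** * Determiners along a right infinite path *)

Section NoMinimalDeterminer.
Variables (k : fieldType) (Q : quiver).
Hypothesis Qi : interval_finite Q.
Variables (v : nat -> Q) (a : forall n, arrow (v n) (v n.+1)).
Notation Rep := (representation k Q).
Notation "''P_' x" := (projective k x : Rep) (at level 8, x at level 2).
Implicit Types L M P : Rep.
Notation ray_mor := (ray_mor k Qi a).
Notation ray1_mor := (ray1_mor k Qi a).
Notation ray_proj := (ray_proj k Qi a).
Notation ray_quot := (ray_quot k Qi a).
Notation q1 := (ray_proj 1).

Lemma ray_quot_map n : exists f : ray_quot n.+1 ~> ray_quot 1, f ** ray_proj n.+1 = q1.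
Proof.
apply: (desc_cokernel (@ray_proj_surj k Q Qi v a n.+1) (@ray_proj_exact k Q Qi v a n.+1)).
by rewrite -ray_mor_ray1 compmA ray_proj_mor comp0m.
Qed.

Lemma ray_proj1_not_split_epi : ~ split_epi q1.
Proof.
move=> [s qs].
have s0 : s = 0.
  apply: (pw_surj_cancel (@ray_proj_surj k Q Qi v a 1)); rewrite comp0m.
  apply: (@endo_projective_comp0 k Q Qi _ _ (s ** q1) (ray_mor 1)).
    exact: path_mor_neq0.
  by rewrite -compmA ray_proj_mor compm0.
have q10 : q1 = 0 by rewrite -[LHS]comp1m -qs s0 compm0 comp0m.
have [w wE] : exists w, rhom (ray_mor 1) (v 0) w = pgen k Qi (v 0).
  by apply/ray_proj_exact; rewrite q10 rhom0.
case: (pselect (inhabited (qpath (v 1) (v 0)))) => [[p]|np].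
  by have := ends_at_start_nil Qi (ray a 1) p.
have : pgen k Qi (v 0) = 0.
  rewrite -wE (@projective_eq0 k Q Qi _ _ w) ?linear0 // => p.
  by apply: np; constructor.
move=> /(congr1 (fun u => pcoef Qi u (qpath_nil (v 0)))).
rewrite pcoef_bas asboolT // pcoef0 => /eqP.
by rewrite oner_eq0.
Qed.

(** M' is the pullback of f' and fn. If P1 -> P0 presents M and F : P0 -> P_(v 0)
    lifts f', then P1 + P_(v n.+1) -> P0 + P_(v 1) presents M'. A
    factorization over M' restricts on P_(v 1) to a scalar endomorphism that
    kills P_(v n.+1), hence to 0, and so descends to M. *)
Lemma ray_pullback n M (f' : M ~> ray_quot 1) (fn : ray_quot n.+1 ~> ray_quot 1) :
  finitely_presented M -> fn ** ray_proj n.+1 = q1 ->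
  exists (M' : Rep) (s : M' ~> M) (t : M' ~> ray_quot n.+1),
    [/\ finitely_presented M', f' ** s = fn ** t &
      (exists h, q1 ** h = f' ** s) -> exists h, q1 ** h = f'].
Proof.
move=> /fp_elim[P1 [P0 [i [p [PP1 PP0 ii ps ex]]]]] fnq.
have pi0 := pw_exact_comp0 ex.
have [F qF] := proj_rep_lift Qi (f' ** p) PP0 (@ray_proj_surj k Q Qi v a 1).
have [u ku] : exists u, ray_mor 1 ** u = F ** i.
  apply: (lift_kernel (@ray_mor_inj k Q Qi v a 1) (@ray_proj_exact k Q Qi v a 1)).
  by rewrite compmA qF -compmA pi0 compm0.
pose d := ray1_mor n.
have di : pw_inj d by apply: path_mor_inj.
have [S0 [[i1 [i2 [p1 [p2 [h1 h2 h3 h4 E]]]]] PS0]] :=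
  proj_rep_sum PP0 (@proj_rep_projective k Q (v 1)).
have [S1 [[j1 [j2 [r1 [r2 [g1 g2 g3 g4 G]]]]] PS1]] :=
  proj_rep_sum PP1 (@proj_rep_projective k Q (v n.+1)).
pose j : S1 ~> S0 := i1 ** (i ** r1) + i2 ** (d ** r2 - u ** r1).
have p1j : p1 ** j = i ** r1 by rewrite compDr !compmA h1 h3 comp1m !comp0m addr0.
have p2j : p2 ** j = d ** r2 - u ** r1.
  by rewrite compDr !compmA h2 h4 !comp0m add0r comp1m.
have ji : pw_inj j.
  move=> x w jw0.
  have r1w : rhom r1 x w = 0.
    by apply: ii; rewrite -rhom_comp -p1j rhom_comp jw0 linear0.
  have r2w : rhom r2 x w = 0.
    apply: di; have /rhom_eqP/(_ x w) := p2j.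
    by rewrite rhom_comp jw0 linear0 rhomB !rhom_comp r1w [rhom u _ _]linear0 subr0.
  by have /rhom_eqP/(_ x w) := G; rewrite !rhomE r1w r2w !linear0 addr0.
have [M' [pi [pis piex]]] := cokernel_exists j.
have pij : pi ** j = 0 := pw_exact_comp0 piex.
have fpM' : finitely_presented M' by exact: (fp_intro PS1 PS0 ji pis piex).
have [s sE] : exists s, s ** pi = p ** p1.
  by apply: (desc_cokernel pis piex); rewrite -compmA p1j compmA pi0 comp0m.
have [t tE] : exists t, t ** pi = ray_proj n.+1 ** (F ** p1 + ray_mor 1 ** p2).
  apply: (desc_cokernel pis piex).
  rewrite -compmA compDl -!compmA p1j p2j compBr (compmA F) -ku.
  rewrite !compmA ray_mor_ray1 addrC subrK compmA ray_proj_mor comp0m //.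
exists M', s, t; split=> //.
  apply: (pw_surj_cancel pis).
  rewrite -!compmA sE tE (compmA fn) fnq compDr !compmA qF ray_proj_mor comp0m.
  by rewrite addr0.
move=> [h qh].
have hpi2 : h ** pi ** i2 = 0.
  have [w kw] : exists w, ray_mor 1 ** w = h ** pi ** i2.
    apply: (lift_kernel (@ray_mor_inj k Q Qi v a 1) (@ray_proj_exact k Q Qi v a 1)).
    rewrite !compmA qh -(compmA f') -!compmA (compmA s) sE -!compmA h3.
    by rewrite !compm0.
  have wd : w ** d = 0.
    apply: (pw_inj_cancel (@ray_mor_inj k Q Qi v a 1)); rewrite compmA kw compm0.
    have -> : h ** pi ** i2 ** d = h ** pi ** (j ** j2).
      rewrite /j compDl -!compmA compBl -!compmA g2 g3 !compm0 subr0 compm1 add0r //.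
    by rewrite compmA -(compmA h) pij compm0 comp0m.
  rewrite -kw (@endo_projective_comp0 k Q Qi _ _ w d _ wd) ?compm0 //.
  exact: path_mor_neq0.
have [h' h'p] : exists h', h' ** p = h ** pi ** i1.
  apply: (desc_cokernel ps ex).
  have : h ** pi ** (j ** j1) = 0 by rewrite compmA -(compmA h) pij compm0 comp0m.
  rewrite /j compDl compDr !compmA hpi2 !comp0m addr0.
  by rewrite -(compmA _ r1) g1 compm1.
exists h'; apply: (pw_surj_cancel ps); rewrite -compmA h'p !compmA qh.
by rewrite -!compmA (compmA s) sE -compmA h1 compm1.
Qed.

(** The morphism f is the projection of P_(v 0) onto its quotient by P_(v 1).
    From a right determiner D one may remove an indecomposable Z0 that detects
    that f does not split: for n large, Z0 detects nothing after pulling back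
    to the quotient of P_(v 0) by P_(v n.+1), whereas by [ray_pullback] all
    failures to factor survive this pullback. *)
Lemma infinite_path_no_minimal_determiner :
  exists (X Y : rep_plus k Q) (f : mor X Y),
    ~ exists D, minimal_right_determiner f D.
Proof.
pose X : rep_plus k Q := ray_projective k v.
pose Xn n : rep_plus k Q := exist _ (ray_quot n) (ray_quot_fp k Qi a n).
exists X, (Xn 1%N), q1 => -[D [[DD Df] Dmin]].
have spl := @rep_plus_idempotents_split k Q Qi.
(* An indecomposable object of D which detects that f does not split. *)
have [Z0 [g0 [DZ0 indZ0 nf0]]] : exists (Z : rep_plus k Q) (g : mor Z (Xn 1%N)),
    [/\ D Z, indecomposable Z & ~ factors_through g (q1 : mor X (Xn 1%N))].
  have /existsNP[Z /not_implyP[DZ /existsNP[g nf]]] :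
      ~ forall Z, D Z -> forall g : mor Z (Xn 1%N),
          factors_through (idm (Xn 1%N) ** g) (q1 : mor X (Xn 1%N)).
    by move=> /Df[s qs]; apply: ray_proj1_not_split_epi; exists s.
  have [Z' [i [p [indZ' pi nf']]]] := indecomposable_retract Qi nf.
  exists Z', (idm (Xn 1%N) ** g ** i); split=> //.
  exact: subcategory_retract spl DD pi DZ.
have locZ0 := rep_plus_local Qi indZ0.
have [Z0n0 _] := indZ0.
have [n Hn] := lift_ray_quot Qi a (svalP Z0).
have {}Hn : forall h : mor Z0 (Xn n.+1), exists h' : mor Z0 X,
    (ray_proj n.+1 : mor X (Xn n.+1)) ** h' = h by exact: Hn (leqnSn n).
have [fn fnq] := ray_quot_map n.
pose D' (Z : rep_plus k Q) :=
  D Z /\ forall (u : mor Z0 Z) (w : mor Z Z0), ~ isomorphism (w ** u).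
have D'sub : subcategory D'.
  have [D0 D1 D2] := DD; split.
  - move=> Z ZZ0; split=> [|u w [z [zl _]]]; first exact: D0.
    by apply: Z0n0; rewrite /is_zero -zl -[w]compm1 ZZ0 compm0 comp0m compm0.
  - move=> A B S AB [DA nA] [DB nB]; split; first exact: D1 AB DA DB.
    move=> u w; have [i1 [i2 [p1 [p2 [h1 h2 h3 h4 E]]]]] := AB.
    have -> : w ** u = (w ** i1) ** (p1 ** u) + (w ** i2) ** (p2 ** u).
      by rewrite -{1}[w]compm1 -E compDr compDl !compmA.
    by move=> /(local_sum_iso locZ0)[/nA|/nB].
  - move=> A B S AB [DS nS]; have [DA DB] := D2 _ _ _ AB DS.
    have [i1 [i2 [p1 [p2 [h1 h2 h3 h4 E]]]]] := AB.
    split; split=> // u w iso; [apply: (nS (i1 ** u) (w ** p1)) | apply: (nS (i2 ** u) (w ** p2))].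
      by rewrite compmA -(compmA w) h1 compm1.
    by rewrite compmA -(compmA w) h2 compm1.
apply: Dmin; exists D'; split=> [|Z [] //|]; last first.
  exists Z0; split=> // -[_ /(_ (idm Z0) (idm Z0))]; apply.
  by exists (idm Z0); rewrite !comp1m.
split=> // X' f'; split=> [ff' Z _ g | H]; first exact: factors_through_comp.
apply: contrapT => nf'.
have [M' [s [t [fpM' sq red]]]] := @ray_pullback n (sval X') f' fn (svalP X') fnq.
pose X'' : rep_plus k Q := exist _ M' fpM'.
have nf'' : ~ factors_through (f' ** (s : mor X'' X')) (q1 : mor X (Xn 1%N)).
  by move=> /red.
have /existsNP[Z /not_implyP[DZ /existsNP[g nfg]]] :
    ~ forall Z, D Z -> forall g : mor Z X'',
        factors_through (f' ** (s : mor X'' X') ** g) (q1 : mor X (Xn 1%N)).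
  by move=> /Df.
have [Z1 [i [p [indZ1 pi nfi]]]] := indecomposable_retract Qi nfg.
have DZ1 : D Z1 := subcategory_retract spl DD pi DZ.
case: (pselect (D' Z1)) => [D'Z1 | nD'].
  by apply: nfi; rewrite -2!compmA; apply: H.
have {}nD' : ~ forall (u : mor Z0 Z1) (w : mor Z1 Z0), ~ isomorphism (w ** u).
  by move=> nD''; apply: nD'.
move: nD' => /existsNP[u /existsNP[w /contrapT iso]].
have [z uzw] := local_iso_comp (rep_plus_local Qi indZ1) Z0n0 iso.
apply: nfi; rewrite -[_ ** i]compm1 -uzw !compmA.
do 2!apply: factors_through_comp.
have [h hE] := Hn ((t : mor X'' (Xn n.+1)) ** g ** i ** u).
exists h; rewrite [LHS](_ : _ = (fn : mor (Xn n.+1) (Xn 1%N)) **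
  ((ray_proj n.+1 : mor X (Xn n.+1)) ** h)); last first.
  by rewrite compmA; congr (_ ** _); apply/esym.
by rewrite hE !compmA; congr (_ ** _ ** _ ** _); apply/esym.
Qed.

End NoMinimalDeterminer.

(** * Finite-dimensional representations *)

Section FiniteDimensional.
Variables (k : fieldType) (Q : quiver).
Notation Rep := (representation k Q).
Notation vtx := {classic Q}.
Notation "''P_' x" := (projective k x : Rep) (at level 8, x at level 2).
Implicit Types L M N P : Rep.

Definition supported (s : seq vtx) M :=
  forall x : Q, (x : vtx) \notin s -> forall u : M x, u = 0.

Definition fin_dim (M : rep k Q) := exists s, supported s M.

Lemma supported_inj s M N (f : M ~> N) : pw_inj f -> supported s N -> supported s M.
Proof. by move=> fi sN x xs u; apply: fi; apply: sN. Qed.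

Lemma supported_surj s M N (f : M ~> N) : pw_surj f -> supported s M -> supported s N.
Proof. by move=> fs sM x xs u; have [w <-] := fs x u; rewrite (sM x xs w) linear0. Qed.

Lemma fin_dim_sum M N S : is_direct_sum (M : rep k Q) N S ->
  fin_dim M -> fin_dim N -> fin_dim S.
Proof.
move=> [i1 [i2 [p1 [p2 [a b c d E]]]]] [s sM] [t tN]; exists (s ++ t) => x.
rewrite mem_cat negb_or => /andP[xs xt] u.
have /rhom_eqP/(_ x u) := E; rewrite !rhomE.
by rewrite (sM x xs (rhom p1 x u)) (tN x xt (rhom p2 x u)) !linear0 addr0.
Qed.

Lemma fin_dim_inj M N (f : M ~> N) : pw_inj f -> fin_dim N -> fin_dim M.
Proof. by move=> fi [s sN]; exists s; apply: supported_inj fi sN. Qed.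

Lemma fin_dim_surj M N (f : M ~> N) : pw_surj f -> fin_dim M -> fin_dim N.
Proof. by move=> fs [s sN]; exists s; apply: supported_surj fs sN. Qed.

Lemma fin_dim_subcategory : subcategory fin_dim.
Proof.
split=> [M M0 | M N S dS fM fN | M N S [i1 [i2 [p1 [p2 [a b c d E]]]]] fS].
- by exists [::] => x _ u; have /rhom_eqP/(_ x u) := M0; rewrite !rhomE.
- exact: fin_dim_sum dS fM fN.
- split.
    apply: (@fin_dim_inj M S i1 _ fS); apply: split_mono_pw_inj; by exists p1.
  apply: (@fin_dim_inj N S i2 _ fS); apply: split_mono_pw_inj; by exists p2.
Qed.

Definition total_dim (s : seq vtx) M := \sum_(x <- s) \dim {: M x}.

(** The horseshoe lemma for 0 -> im y -> M -> C -> 0, where im y is presented by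
    j : R -> P. The morphism sg corrects the lift of the presentation of C by
    elements of im y. *)
Lemma fp_extension (Qi : interval_finite Q) R P M C
    (j : R ~> P) (y : P ~> M) (c : M ~> C) :
  proj_rep R -> proj_rep P -> pw_inj j -> pw_exact y j ->
  pw_surj c -> pw_exact c y -> finitely_presented C -> finitely_presented M.
Proof.
move=> PR PP ji yj cs cy /fp_elim[P1 [P0 [i [p [PP1 PP0 ii ps ex]]]]].
have yj0 := pw_exact_comp0 yj; have cy0 := pw_exact_comp0 cy.
have pi0 := pw_exact_comp0 ex.
have [pi cpi] := proj_rep_lift Qi p PP0 cs.
have [I [e [io [es ioi ioe]]]] := image_exists y.
have [t0 iot] : exists t, io ** t = pi ** i.
  apply: lift_mono => // x u.
  have /cy[w yw] : rhom c x (rhom (pi ** i) x u) = 0.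
    by rewrite -rhom_comp compmA cpi pi0 rhom0.
  by exists (rhom e x w); rewrite -rhom_comp ioe.
have [sg esg] := proj_rep_lift Qi t0 PP1 es.
have ysg : y ** sg = pi ** i by rewrite -ioe -compmA esg.
have [S0 [[i1 [i2 [p1 [p2 [h1 h2 h3 h4 E]]]]] PS0]] := proj_rep_sum PP0 PP.
have [S1 [[j1 [j2 [r1 [r2 [g1 g2 g3 g4 G]]]]] PS1]] := proj_rep_sum PP1 PR.
pose jj : S1 ~> S0 := i1 ** (i ** r1) + i2 ** (j ** r2 - sg ** r1).
have p1j : p1 ** jj = i ** r1 by rewrite compDr !compmA h1 h3 comp1m !comp0m addr0.
have p2j : p2 ** jj = j ** r2 - sg ** r1.
  by rewrite compDr !compmA h2 h4 !comp0m add0r comp1m.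
pose pp : S0 ~> M := pi ** p1 + y ** p2.
apply: (@fp_intro _ _ S1 S0 M jj pp PS1 PS0).
- move=> x w jw0.
  have r1w : rhom r1 x w = 0.
    by apply: ii; rewrite -rhom_comp -p1j rhom_comp jw0 linear0.
  have r2w : rhom r2 x w = 0.
    apply: ji; have /rhom_eqP/(_ x w) := p2j.
    by rewrite rhom_comp jw0 linear0 rhomB !rhom_comp r1w [rhom sg _ _]linear0 subr0.
  by have /rhom_eqP/(_ x w) := G; rewrite !rhomE r1w r2w !linear0 addr0.
- move=> x m; have [b pb] := ps x (rhom c x m).
  have /cy[w yw] : rhom c x (m - rhom pi x b) = 0.
    by rewrite linearB /= -rhom_comp cpi pb subrr.
  exists (rhom i1 x b + rhom i2 x w).
  have p1E : rhom p1 x (rhom i1 x b + rhom i2 x w) = b.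
    by rewrite rhomDr -!rhom_comp h1 h3 rhom0 rhom_id addr0.
  have p2E : rhom p2 x (rhom i1 x b + rhom i2 x w) = w.
    by rewrite rhomDr -!rhom_comp h2 h4 rhom0 rhom_id add0r.
  by rewrite rhomD !rhom_comp p1E p2E yw addrC subrK.
- move=> x w; split=> [|[b <-]]; last first.
    rewrite -rhom_comp compDl -!compmA p1j p2j compBr !compmA yj0 comp0m ysg.
    by rewrite sub0r subrr rhom0.
  rewrite rhomD !rhom_comp => ppw.
  have /ex[b ib] : rhom p x (rhom p1 x w) = 0.
    have := congr1 (rhom c x) ppw; rewrite linearD linear0 /= -rhom_comp cpi.
    by rewrite -[rhom c x (rhom y x _)]rhom_comp cy0 rhom0 addr0.
  have /yj[r jr] : rhom y x (rhom p2 x w + rhom sg x b) = 0.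
    by rewrite linearD /= -[rhom y x (rhom sg x b)]rhom_comp ysg rhom_comp ib addrC.
  exists (rhom j1 x b + rhom j2 x r).
  have r1E : rhom r1 x (rhom j1 x b + rhom j2 x r) = b.
    by rewrite linearD /= -!rhom_comp g1 g3 rhom0 rhom_id addr0.
  have r2E : rhom r2 x (rhom j1 x b + rhom j2 x r) = r.
    by rewrite linearD /= -!rhom_comp g2 g4 rhom0 rhom_id add0r.
  have /rhom_eqP/(_ x w) := E; rewrite rhom_id rhomD !rhom_comp => wE.
  rewrite -[RHS]wE rhomD !rhom_comp rhomB !rhom_comp r1E r2E ib jr.
  by rewrite addrK.
Qed.

Hypothesis Qslf : strongly_locally_finite Q.
Let Qi : interval_finite Q := proj2 Qslf.
Let Qlf : locally_finite Q := proj1 Qslf.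

Lemma out_arrows (x : Q) : exists l : seq {classic {y : Q & arrow x y}},
  uniq l /\ forall y (a : arrow x y), (existT _ y a : {classic _}) \in l.
Proof.
have [fin _] := Qlf x.
have [l lE] := (@finite_seqP {classic {y : Q & arrow x y}} _).1 fin.
exists (undup l); split=> [|y a]; first exact: undup_uniq.
rewrite mem_undup.
have : [set` l]%classic (existT _ y a : {classic _}) by rewrite -lE.
by [].
Qed.

Lemma in_arrows (x : Q) : exists l : seq {classic {y : Q & arrow y x}},
  forall y (a : arrow y x), (existT _ y a : {classic _}) \in l.
Proof.
have [_ fin] := Qlf x.
have [l lE] := (@finite_seqP {classic {y : Q & arrow y x}} _).1 fin.
exists l => y a.
have : [set` l]%classic (existT _ y a : {classic _}) by rewrite -lE.
by [].
Qed.

(** The radical of P_x is the direct sum of the P_y over the arrows x -> y: the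
    sum is direct as a nontrivial path has only one first arrow. The arrows
    are added one at a time. *)
Lemma radical_exists (x : Q) : exists (R : Rep) (j : R ~> 'P_x),
  [/\ proj_rep R, pw_inj j & forall z u, (exists w, rhom j z w = u) <->
    forall q : qpath x z, qlen q = 0%N -> pcoef Qi u q = 0].
Proof.
have [l [ul lP]] := out_arrows x.
suff [R [j [PR ji jE]]] : exists (R : Rep) (j : R ~> 'P_x),
    [/\ proj_rep R, pw_inj j & forall z u, (exists w, rhom j z w = u) <->
      forall q : qpath x z, pcoef Qi u q <> 0 ->
        exists y (a : arrow x y) p, (existT _ y a : {classic _}) \in l /\ q = qcat (qarr a) p].
  exists R, j; split=> // z u; split=> [/jE H q q0 | H].
    apply: contrapT => /H[y [a [p [_ qE]]]].
    by move: q0; rewrite qE qlen_cat.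
  apply/jE => q qn0; have [q0|[y [a [p qE]]]] := qpath_uncons q.
    by case: qn0; apply: H.
  by exists y, a, p; split=> //; apply: lP.
elim: l ul {lP} => [_ | [y a] l IH /= /andP[al ul]].
  have [Z Z0] := zero_rep_exists k Q.
  have [D0 _ _] := proj_rep_subcategory k Q.
  exists Z, 0; split; first exact: D0.
    by move=> z u _; have /rhom_eqP/(_ z u) := Z0; rewrite !rhomE.
  move=> z u; split=> [[w <-] q|H]; first by rewrite rhom0 pcoef0.
  exists 0; rewrite rhom0; apply: (pcoefP (Qi := Qi)) => q; rewrite pcoef0.
  by apply/esym; apply: contrapT => /H[y [a [p []]]].
have [R [j [PR ji jE]]] := IH ul.
have [S [[i1 [i2 [p1 [p2 [h1 h2 h3 h4 E]]]]] PS]] :=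
  proj_rep_sum (@proj_rep_projective k Q y) PR.
pose ka := path_mor k Qi (qarr a).
pose jj : S ~> 'P_x := ka ** p1 + j ** p2.
have jc z r (q : qpath x z) p : q = qcat (qarr a) p -> pcoef Qi (rhom j z r) q = 0.
  move=> qE; apply: contrapT => nz.
  have [|y' [a' [p' [a'l q'E]]]] := (jE z (rhom j z r)).1 _ q nz; first by exists r.
  move: al; rewrite qE in q'E; rewrite (qarr_cat_inj q'E) a'l //.
have kc z r (q : qpath x z) : (forall p, q <> qcat (qarr a) p) -> pcoef Qi (rhom ka z r) q = 0.
  exact: path_mor_coef0.
have jjE z w : rhom jj z w = rhom ka z (rhom p1 z w) + rhom j z (rhom p2 z w).
  by rewrite rhomD !rhom_comp.
have wE z w : rhom i1 z (rhom p1 z w) + rhom i2 z (rhom p2 z w) = w.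
  by have /rhom_eqP/(_ z w) := E; rewrite rhomD !rhom_comp rhom_id.
exists S, jj; split=> // [z w | z u].
  rewrite jjE => s0.
  have p1w : rhom p1 z w = 0.
    apply: (pcoefP (Qi := Qi)) => p; rewrite pcoef0.
    have := congr1 (fun u => pcoef Qi u (qcat (qarr a) p)) s0.
    by rewrite pcoefD (jc _ _ _ p) // addr0 pcoef0 path_mor_coef.
  have p2w : rhom p2 z w = 0 by apply: ji; move: s0; rewrite p1w linear0 add0r.
  by rewrite -(wE z w) p1w p2w !linear0 addr0.
split=> [[w <-] q | H].
  rewrite jjE pcoefD => nz.
  case: (pselect (exists p, q = qcat (qarr a) p)) => [[p qE] | np].
    by exists y, a, p; rewrite mem_head.
  rewrite kc ?add0r in nz; last by move=> p qE; apply: np; exists p.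
  have [|y' [a' [p' [a'l q'E]]]] := (jE z _).1 _ q nz; first by exists (rhom p2 z w).
  by exists y', a', p'; split=> //; rewrite in_cons a'l orbT.
pose u1 : 'P_y z := \sum_(p : fqpath y z) pcoef Qi u (qcat (qarr a) (qpath_of p)) *: pbas k Qi (qpath_of p).
have u1E p : pcoef Qi u1 p = pcoef Qi u (qcat (qarr a) p).
  rewrite pcoef_sum (bigD1 (fqpath_of Qi p)) //= big1 => [|q qp].
    by rewrite pcoefZ pcoef_bas fqpath_ofK asboolT // mulr1 addr0.
  rewrite pcoefZ pcoef_bas asboolF ?mulr0 // => e.
  by move: qp; rewrite e qpath_ofK eqxx.
have [r jr] : exists r, rhom j z r = u - rhom ka z u1.
  apply/jE => q; rewrite pcoefD pcoefN => nz.
  case: (pselect (exists p, q = qcat (qarr a) p)) => [[p qE] | np].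
    by case: nz; rewrite qE path_mor_coef u1E subrr.
  rewrite kc ?subr0 in nz; last by move=> p qE; apply: np; exists p.
  have [y' [a' [p' [a'l q'E]]]] := H q nz; exists y', a', p'; split=> //.
  move: a'l; rewrite in_cons => /orP[/eqP e|//].
  have /= ey := projT1_eq e; subst y'; case: np; exists p'.
  by rewrite q'E (existT_inj e).
exists (rhom i1 z u1 + rhom i2 z r).
have p1E : rhom p1 z (rhom i1 z u1 + rhom i2 z r) = u1.
  by rewrite rhomDr -!rhom_comp h1 h3 rhom0 rhom_id addr0.
have p2E : rhom p2 z (rhom i1 z u1 + rhom i2 z r) = r.
  by rewrite rhomDr -!rhom_comp h2 h4 rhom0 rhom_id add0r.
by rewrite jjE p1E p2E jr addrC subrK.
Qed.

End FiniteDimensional.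

(** * Quivers without right infinite paths *)

Section NoRightInfinitePath.
Variables (k : fieldType) (Q : quiver).
Notation Rep := (representation k Q).
Notation vtx := {classic Q}.
Notation "''P_' x" := (projective k x : Rep) (at level 8, x at level 2).
Implicit Types L M N P : Rep.
Hypothesis Qslf : strongly_locally_finite Q.
Let Qi : interval_finite Q := proj2 Qslf.
Hypothesis noray : ~ has_right_infinite_path Q.

Lemma no_ray_property (P : Q -> Prop) :
  (forall x, P x -> exists y (a : arrow x y), P y) -> forall x, ~ P x.
Proof.
move=> step x0 Px0; apply: noray.
have next (x : {x : Q | P x}) : {y : {y : Q | P y} & arrow (sval x) (sval y)}.
  have [y /cid[a Py]] := cid (step (sval x) (svalP x)).
  by exists (exist _ y Py).
pose v n := iter n (fun x => projT1 (next x)) (exist P x0 Px0).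
by exists (fun n => sval (v n)); constructor => n; exact: (projT2 (next (v n))).
Qed.

(** König's lemma: a vertex that reaches infinitely many others has a direct
    successor with this property. *)
Lemma reachable_finite (x : Q) :
  exists s : seq vtx, forall y : Q, qpath x y -> (y : vtx) \in s.
Proof.
apply: contrapT; move: x; apply: no_ray_property => x bad.
apply: contrapT => good; apply: bad.
have [l [_ lP]] := out_arrows Qslf x.
have /choice[s sP] : forall t : {classic {y : Q & arrow x y}},
    exists s : seq vtx, forall y : Q, qpath (projT1 t) y -> (y : vtx) \in s.
  move=> [y a]; apply: contrapT => bad; apply: good; exists y, a; exact: bad.
exists ((x : vtx) :: flatten [seq s t | t <- l]) => z p.
have [p0|[y [a [q _]]]] := qpath_uncons p.
  have /= ez := projT1_eq (qlen0 p0).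
  by rewrite in_cons; apply/orP; left; apply/eqP.
rewrite in_cons; apply/orP; right; apply/flatten_mapP.
by exists (existT _ y a : {classic _}); [apply: lP | apply: sP].
Qed.

Lemma projective_fin_dim (x : Q) : fin_dim (projective k x).
Proof.
have [s sP] := reachable_finite x; exists s => y ys u.
apply: (projective_eq0 Qi) => p; by rewrite sP in ys.
Qed.

Lemma fp_fin_dim M : finitely_presented M -> fin_dim M.
Proof.
move=> /fp_elim[P1 [P0 [i [p [_ PP0 _ ps _]]]]].
apply: fin_dim_surj ps _; apply: PP0; first exact: fin_dim_subcategory.
by move=> _ [x ->]; apply: projective_fin_dim.
Qed.

Definition socle_elt M (x : Q) (m : M x) :=
  m <> 0 /\ forall y (a : arrow x y), rmap M a m = 0.

Lemma socle_elt_exists M (x : Q) (m : M x) : m <> 0 ->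
  exists y (m' : M y), socle_elt m'.
Proof.
move=> m0; apply: contrapT => nosoc.
suff : ~ exists m : M x, m <> 0 by apply; exists m.
move: x {m m0}; apply: no_ray_property => x [m m0].
apply: contrapT => nostep; apply: nosoc; exists x, m; split=> // y a.
by apply: contrapT => am0; apply: nostep; exists y, a, (rmap M a m).
Qed.

(** A socle element spans a simple subrepresentation, which is P_x modulo its
    radical. *)
Lemma yoneda_socle M (x : Q) (m : M x) z (u : 'P_x z) : socle_elt m ->
  rhom (yoneda Qi m) z u = 0 <-> forall q : qpath x z, qlen q = 0%N -> pcoef Qi u q = 0.
Proof.
move=> [m0 mk].
have act0 (q : qpath x z) : qlen q != 0%N -> path_act M q m = 0.
  have [-> //|[y [a [p ->]]]] := qpath_uncons q => _.
  by rewrite path_act_cat path_act_arr mk linear0.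
rewrite yonedaE; split=> [s0 q q0 | H].
  have e := qlen0 q0; have /= ez := projT1_eq e; subst z.
  move: s0; rewrite (bigD1 (fqpath_of Qi q)) //= big1 => [|p pq].
    rewrite fqpath_ofK (qlen0_nil q0) path_act_nil addr0 => /eqP.
    by rewrite scaler_eq0 => /orP[/eqP //|/eqP].
  rewrite act0 ?scaler0 //; apply/eqP => p0; move/eqP: pq; apply.
  by rewrite (qlen0_nil q0) -(qlen0_nil p0) qpath_ofK.
rewrite big1 // => q _; have [q0|qn0] := eqVneq (qlen (qpath_of q : qpath x z)) 0%N.
  by rewrite H // scale0r.
by rewrite act0 ?scaler0.
Qed.

(** Induction on the dimension: by [fp_extension], the simple subrepresentation
    spanned by a socle element may be divided out. *)
Lemma fin_dim_fp M : fin_dim M -> finitely_presented M.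
Proof.
move=> [s sM]; move: {2}(total_dim s M) (leqnn (total_dim s M)) => n.
elim: n M sM => [|n IH] M sM dM;
  case: (pselect (exists x (m : M x), m <> 0)) => [[x0 [m0 m0n]]|nz].
- have xs : (x0 : vtx) \in s by apply: contraPT m0n => xs; case; apply: sM.
  case: m0n; apply/eqP; rewrite -memv0.
  have : (\dim {: M x0} <= 0)%N.
    by rewrite (leq_trans _ dM) // /total_dim (big_rem (x0 : vtx)) //= leq_addr.
  by rewrite leqn0 dimv_eq0 => /eqP <-; rewrite memvf.
- apply: proj_rep_fp; have [D0 _ _] := proj_rep_subcategory k Q; apply: D0.
  apply/rhom_eqP => x u; rewrite rhomE rhom0; apply: contrapT => u0.
  by apply: nz; exists x, u.
- have [x [m soc]] := socle_elt_exists m0n.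
  have [R [j [PR ji jE]]] := radical_exists k Qslf x.
  have [C [c [cs cE]]] := cokernel_exists (yoneda Qi m).
  apply: (fp_extension Qi PR (@proj_rep_projective k Q x) ji _ cs cE).
    by move=> z u; rewrite (yoneda_socle _ soc); split=> [/jE|H]; last exact/jE.
  apply: IH; first exact: supported_surj cs sM.
  have [mn0 _] := soc.
  have xs : (x : vtx) \in s by apply: contraPT mn0 => xs; case; apply: sM.
  rewrite -ltnS (leq_trans _ dM) // /total_dim !(big_rem _ xs) /= -addSn leq_add //; last first.
    by apply: leq_sum => y _; apply: pw_surj_dim cs.
  rewrite -(pw_surj_limg x cs) -(limg_ker_dim (rhom c x) fullv) -[X in (X < _)%N]add0n ltn_add2r.
  rewrite lt0n dimv_eq0; apply: contra_notN mn0 => /eqP k0.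
  have : m \in ({: M x} :&: lker (rhom c x))%VS.
    rewrite memv_cap memvf memv_ker; apply/eqP/cE.
    by exists (pgen k Qi x); rewrite yoneda_gen.
  by rewrite k0 memv0 => /eqP.
- apply: proj_rep_fp; have [D0 _ _] := proj_rep_subcategory k Q; apply: D0.
  apply/rhom_eqP => x u; rewrite rhomE rhom0; apply: contrapT => u0.
  by apply: nz; exists x, u.
Qed.

End NoRightInfinitePath.

(** * Linear duality for systems of linear maps *)

Section LinearDuality.
Variable k : fieldType.

Definition basis_vec (V : vectType k) (i : 'I_(\dim {:V})) : V := (vbasis {:V})`_i.
Definition basis_coord (V : vectType k) (i : 'I_(\dim {:V})) (u : V) : k := coord (vbasis {:V}) i u.

Lemma basis_coord_sum (V : vectType k) (u : V) : u = \sum_i basis_coord i u *: basis_vec i.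
Proof. exact: coord_vbasis (memvf u). Qed.

Lemma basis_coord_vec (V : vectType k) (i j : 'I_(\dim {:V})) : basis_coord j (basis_vec i) = (i == j)%:R.
Proof. exact: coord_free (basis_free (vbasisP _)). Qed.

Lemma basis_coord_linear (V : vectType k) i c (u v : V) : basis_coord i (c *: u + v) = c * basis_coord i u + basis_coord i v.
Proof. by rewrite /basis_coord linearP. Qed.

Lemma basis_coordD (V : vectType k) i (u v : V) : basis_coord i (u + v) = basis_coord i u + basis_coord i v.
Proof. exact: linearD. Qed.

Lemma basis_coord0 (V : vectType k) i : basis_coord i (0 : V) = 0.
Proof. exact: linear0. Qed.

Lemma basis_coord_big (V : vectType k) i (I : finType) (F : I -> V) :
  basis_coord i (\sum_j F j) = \sum_j basis_coord i (F j).
Proof. exact: linear_sum. Qed.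

Lemma basis_coordZ (V : vectType k) i c (u : V) : basis_coord i (c *: u) = c * basis_coord i u.
Proof. exact: linearZ. Qed.

Definition lfun_trace (V : vectType k) (phi : 'End(V)) : k := \sum_i basis_coord i (phi (basis_vec i)).

Lemma lfun_traceD (V : vectType k) (phi psi : 'End(V)) : lfun_trace (phi + psi) = lfun_trace phi + lfun_trace psi.
Proof. by rewrite -big_split; apply: eq_bigr => i _; rewrite add_lfunE basis_coordD. Qed.

Lemma lfun_trace0 (V : vectType k) : lfun_trace (0 : 'End(V)) = 0.
Proof. by rewrite /lfun_trace big1 // => i _; rewrite zero_lfunE basis_coord0. Qed.

Section RankSum.
Variables (U V : vectType k) (c : 'I_(\dim {:U}) -> 'I_(\dim {:V}) -> k).

(** The map V -> U which corresponds under the trace pairing to the functional on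
    Hom(U, V) with coefficients c. *)
Definition coef_fun (v : V) : U := \sum_l (\sum_i c l i * basis_coord i v) *: basis_vec l.
Fact coef_fun_linear : linear coef_fun.
Proof.
move=> a u v; rewrite /coef_fun scaler_sumr -big_split /=; apply: eq_bigr => l _.
rewrite scalerA -scalerDl mulr_sumr -big_split /=; congr (_ *: _).
by apply: eq_bigr => i _; rewrite basis_coord_linear mulrDr mulrCA.
Qed.
HB.instance Definition _ := GRing.isLinear.Build k _ _ _ coef_fun coef_fun_linear.

Lemma lfun_trace_coef (e : 'Hom(U, V)) :
  lfun_trace (e \o linfun coef_fun)%VF = \sum_l \sum_i c l i * basis_coord i (e (basis_vec l)).
Proof.
rewrite exchange_big /=; apply: eq_bigr => i _.
rewrite comp_lfunE lfunE /= /coef_fun linear_sum basis_coord_big; apply: eq_bigr => l _.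
rewrite linearZ basis_coordZ; congr (_ * _); rewrite (bigD1 i) //= big1 => [|j ji].
  by rewrite basis_coord_vec eqxx mulr1 addr0.
by rewrite basis_coord_vec eq_sym (negPf ji) mulr0.
Qed.
End RankSum.

(** As w is not in the subspace I, some linear functional vanishes on I but not
    at w; since the trace pairs Hom(U, V) perfectly with Hom(V, U), it is
    given by traces. *)
Lemma linear_duality (J : finType) (U V : J -> vectType k)
    (I : (forall j, 'Hom(U j, V j)) -> Prop) (w : forall j, 'Hom(U j, V j)) :
  I (fun j => 0) ->
  (forall c e e', I e -> I e' -> I (fun j => c *: e j + e' j)) ->
  (forall e, (forall j, e j = w j) -> ~ I e) ->
  exists lambda : forall j, 'Hom(V j, U j),
    (forall e, I e -> \sum_j lfun_trace (e j \o lambda j)%VF = 0) /\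
    \sum_j lfun_trace (w j \o lambda j)%VF <> 0.
Proof.
move=> I0 Ilin Iw.
pose K : finType := {j : J & ('I_(\dim {:U j}) * 'I_(\dim {:V j}))%type}.
pose W : vectType k := {ffun K -> k^o}.
pose cm (e : forall j, 'Hom(U j, V j)) : W :=
  [ffun t : K => (basis_coord (tagged t).2 (e (tag t) (basis_vec (tagged t).1)) : k^o)].
have cm0 : cm (fun j => 0) = 0.
  by apply/ffunP => t; rewrite !ffunE zero_lfunE basis_coord0.
have cmlin c e e' : cm (fun j => c *: e j + e' j) = c *: cm e + cm e'.
  by apply/ffunP => t; rewrite !ffunE add_lfunE scale_lfunE basis_coord_linear.
have cmI e e' : cm e = cm e' -> forall j, e j = e' j.
  move=> ee j; apply/lfunP => u; rewrite [u]basis_coord_sum !linear_sum; apply: eq_bigr => l _.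
  rewrite !linearZ; congr (_ *: _); rewrite /= [LHS]basis_coord_sum [RHS]basis_coord_sum; apply: eq_bigr => i _.
  congr (_ *: _); have /ffunP/(_ (existT _ j (l, i))) := ee.
  by rewrite !ffunE.
have [||S SE] := @pred_vspace k W (fun x => exists2 e, I e & cm e = x).
- by exists (fun j => 0).
- move=> c _ _ [e Ie <-] [e' Ie' <-]; exists (fun j => c *: e j + e' j) => //.
  exact: Ilin.
have [W' [q [s [_ qS]]]] := quotient_space S.
have qw : q (cm w) <> 0.
  by move=> /qS/SE[e Ie /cmI ew]; apply: (Iw e).
have [i qi] : exists i, basis_coord i (q (cm w)) <> 0.
  apply: contrapT => H; apply: qw; rewrite [LHS]basis_coord_sum big1 // => i _.
  suff -> : basis_coord i (q (cm w)) = 0 by rewrite scale0r.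
  by apply: contrapT => qi; apply: H; exists i.
pose c (t : K) : k := basis_coord i (q [ffun t' => ((t' == t)%:R : k^o)]).
have phiE e : basis_coord i (q (cm e)) =
    \sum_j \sum_l \sum_m c (existT _ j (l, m)) * basis_coord m (e j (basis_vec l)).
  have {1}-> : cm e = \sum_t (cm e t) *: ([ffun t' => ((t' == t)%:R : k^o)] : W).
    apply/ffunP => t; rewrite sum_ffunE (bigD1 t) //= big1 => [|t' t't].
      by rewrite !ffunE eqxx addr0 [X in _ = X]mulr1.
    by rewrite !ffunE eq_sym (negPf t't) [LHS]mulr0.
  rewrite linear_sum basis_coord_big.
  transitivity (\sum_j \sum_(p : 'I_(\dim {:U j}) * 'I_(\dim {:V j}))
      c (existT _ j p) * basis_coord p.2 (e j (basis_vec p.1))); last first.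
    apply: eq_bigr => j _.
    by rewrite [RHS]pair_big; apply: eq_bigr => -[l m] _.
  rewrite (sig_big_dep (fun=> true) (fun _ _ => true)
    (fun j (p : 'I_(\dim {:U j}) * 'I_(\dim {:V j})) =>
      c (existT _ j p) * basis_coord p.2 (e j (basis_vec p.1)))) /=.
  apply: eq_bigr => -[j p] _ /=; rewrite linearZ basis_coordZ mulrC /cm ffunE //.
pose lam j : 'Hom(V j, U j) := linfun (coef_fun (fun l m => c (existT _ j (l, m)))).
have lamE e : \sum_j lfun_trace (e j \o lam j)%VF = basis_coord i (q (cm e)).
  by rewrite phiE; apply: eq_bigr => j _; rewrite lfun_trace_coef.
exists lam; split=> [e Ie | ]; rewrite lamE //.
suff -> : q (cm e) = 0 by rewrite basis_coord0.
by apply/qS/SE; exists e.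
Qed.

End LinearDuality.

(** * Universal linear relations *)

Section Generated.
Variables (k : fieldType) (Q : quiver).
Notation Rep := (representation k Q).
Notation vtx := {classic Q}.
Implicit Types L M N P : Rep.
Hypothesis Qi : interval_finite Q.
Variables (J : finType) (src : J -> Q) (V : J -> vectType k).

(** Generators indexed by J, the j-th of them a whole space V j at the vertex
    src j. *)
Definition family M := forall j, 'Hom(V j, M (src j)).

Definition push M N (f : M ~> N) (g : family M) : family N :=
  fun j => (rhom f (src j) \o g j)%VF.

(** No proper subrepresentation contains the family. *)
Definition generates N (g : family N) :=
  forall I (i : I ~> N) (g' : family I), pw_inj i -> (forall j, g j = push i g' j) -> pw_surj i.

(** Every path from a source to z contributes at most one copy of its space at
    z. *)
Definition gen_bound (z : Q) : nat :=
  \sum_(t : {j : J & fqpath (src j) z}) \dim {: V (tag t)}.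

Lemma generated_subrep M (g : family M) :
  exists N (i : N ~> M) (g' : family N),
    [/\ pw_inj i, forall j, g j = push i g' j, generates g' &
        forall z, (\dim {: N z} <= gen_bound z)%N].
Proof.
pose img z (t : {j : J & fqpath (src j) z}) : {vspace M z} :=
  limg (path_act M (qpath_of (tagged t)) \o g (tag t))%VF.
pose U z := (\sum_(t : {j : J & fqpath (src j) z}) img z t)%VS.
have memU z (j : J) (p : qpath (src j) z) v : path_act M p (g j v) \in U z.
  apply: (subvP (sumv_sup (existT _ j (fqpath_of Qi p)) _ (subvv _))) => //.
  by apply/memv_imgP; exists v; rewrite ?memvf //= fqpath_ofK comp_lfunE.
have [|N [i [ii iU]]] := @subrep_exists k Q M U.
  move=> x y a u /memv_sumP[vs vsP ->]; rewrite linear_sum; apply: memv_suml => t _.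
  have /memv_imgP[w _ ->] := vsP t isT.
  by rewrite /= comp_lfunE -path_act_snoc; apply: memU.
have ig j : forall u, exists w, rhom i (src j) w = g j u.
  by move=> u; apply/iU; have := @memU (src j) j (qpath_nil _) u; rewrite path_act_nil.
pose g' : family N := fun j => ((rhom i (src j))^-1 \o g j)%VF.
have ig' j : g j = push i g' j.
  apply/lfunP => u; rewrite !comp_lfunE limg_lfunVK //.
  by have [w <-] := ig j u; rewrite memv_img ?memvf.
exists N, i, g'; split=> // [L l h li gl | z].
  move=> z u.
  have /iU/memv_sumP[vs vsP uE] : exists w, rhom i z w = rhom i z u by exists u.
  have ex t : exists w, rhom i z (rhom l z w) = vs t.
    have /memv_imgP[v _ ->] := vsP t isT.
    exists (path_act L (qpath_of (tagged t)) (h (tag t) v)).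
    by rewrite comp_lfunE !rhom_path_act ig' comp_lfunE gl comp_lfunE.
  have [w wE] := choice ex.
  exists (\sum_t w t); apply: (pw_injP ii); rewrite uE !rhom_sum.
  by apply: eq_bigr.
have -> : \dim {: N z} = \dim (U z).
  rewrite -(limg_dim_eq (f := rhom i z)); last first.
    by rewrite (eqP (pw_inj_lker z ii)) capv0.
  congr dimv; apply/vspaceP => u; apply/memv_imgP/idP => [[w _ ->] | /iU[w <-]].
    by apply/iU; exists w.
  by exists w; rewrite ?memvf.
apply: leq_trans (dimv_leq_sum _ _ _) _; apply: leq_sum => t _.
by rewrite /img -(limg_ker_dim (path_act M (qpath_of (tagged t)) \o g (tag t))%VF) leq_addl.
Qed.

Hypothesis reach : forall x : Q, exists s : seq vtx, forall y : Q, qpath x y -> (y : vtx) \in s.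

Lemma gen_bound_supported :
  exists s : seq vtx, forall z : Q, (z : vtx) \notin s -> gen_bound z = 0%N.
Proof.
have /choice[s sP] : forall j, exists s : seq vtx, forall y : Q, qpath (src j) y -> (y : vtx) \in s.
  by move=> j; apply: reach.
exists (flatten [seq s j | j <- enum J]) => z zs; rewrite /gen_bound big1 // => -[j p] _.
case/negP: zs; apply/flatten_mapP; exists j; first by rewrite mem_enum.
exact: sP (qpath_of p).
Qed.

(** The values [E h] are the left-hand sides of a system of linear equations in
    the vertexwise maps h : M -> X, natural in M. *)
Variable X : Rep.
Variable E : forall M, (forall x, 'Hom(M x, X x)) -> forall j, 'Hom(M (src j), V j).
Hypothesis E_nat : forall M N (i : M ~> N) (h : forall x, 'Hom(N x, X x)) j,
  E (fun x => (h x \o rhom i x)%VF) j = (E h j \o rhom i (src j))%VF.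

(** By the trace pairing, g is a linear relation between the left-hand sides of
    the system E, as h varies. *)
Definition relation M (g : family M) :=
  forall h, \sum_j lfun_trace (E (M := M) h j \o g j)%VF = 0.

Lemma relation_sub M N (i : N ~> M) (g : family M) (g' : family N) :
  pw_inj i -> (forall j, g j = push i g' j) -> relation g -> relation g'.
Proof.
move=> ii gE rg h.
pose h' x := (h x \o (rhom i x)^-1)%VF.
have -> : h = (fun x => h' x \o rhom i x)%VF.
  apply: functional_extensionality_dep => x; apply/lfunP => u.
  by rewrite !comp_lfunE lker0_lfunK // pw_inj_lker.
rewrite -[RHS](rg h'); apply: eq_bigr => j _.
by rewrite E_nat gE comp_lfunA.
Qed.

Lemma relation_sum L M S (i1 : L ~> S) (i2 : M ~> S) (c : family L) (m : family M) :
  relation c -> relation m -> relation (fun j => push i1 c j + push i2 m j).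
Proof.
move=> rc rm h.
have e1 := rc (fun x => h x \o rhom i1 x)%VF.
have e2 := rm (fun x => h x \o rhom i2 x)%VF.
apply: etrans (etrans (congr2 +%R e1 e2) (addr0 0)).
rewrite -big_split /=; apply: eq_bigr => j _.
by rewrite !E_nat comp_lfunDr lfun_traceD !comp_lfunA.
Qed.

(** Relations generate representations of bounded dimension, so there is one,
    (C, c), of largest dimension among those that are generated by their
    family. Given any relation m in M, the pair (c, m) generates a subobject of
    C + M that projects onto C, by maximality isomorphically; it is thus
    the graph of a morphism C -> M, which maps c to m. *)
Lemma universal_relation : exists C (c : family C),
  [/\ fin_dim C, relation c &
   forall M (m : family M), relation m -> exists g : C ~> M, forall j, m j = push g c j].
Proof.
have [s sB] := gen_bound_supported.
pose good (n : nat) := exists (C : Rep) (c : family C), [/\ relation c, generates c,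
  forall z, (\dim {: C z} <= gen_bound z)%N & total_dim s C = n].
have supp (C : Rep) : (forall z, (\dim {: C z} <= gen_bound z)%N) -> supported s C.
  move=> CB z zs u; have := CB z; rewrite sB // leqn0 dimv_eq0 => /eqP z0.
  by apply/eqP; rewrite -memv0 -z0 memvf.
have ex0 : exists n, `[< good n >].
  have r0 : relation (fun j => 0 : 'Hom(V j, X (src j))).
    by move=> h; rewrite big1 // => j _; rewrite comp_lfun0r lfun_trace0.
  have [N [i [g' [ii ig gg Nb]]]] := generated_subrep (fun j => 0 : 'Hom(V j, X (src j))).
  exists (total_dim s N); apply/asboolP; exists N, g'; split=> //.
  exact: relation_sub ig r0.
have bound n : `[< good n >] -> (n <= \sum_(z <- s) gen_bound z)%N.
  by move=> /asboolP[C [c [_ _ CB <-]]]; apply: leq_sum => z _; apply: CB.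
case: (ex_maxnP ex0 bound) => n /asboolP[C [c [rc gc CB Cn]]] maxn.
exists C, c; split=> // [|M m rm]; first by exists s; apply: supp.
have [S [i1 [i2 [p1 [p2 [h1 h2 h3 h4 ES]]]]]] := direct_sum_exists C M.
pose cm : family S := fun j => push i1 c j + push i2 m j.
have p1cm j : push p1 cm j = c j.
  apply/lfunP => u; rewrite comp_lfunE add_lfunE !comp_lfunE rhomDr -!rhom_comp h1 h3.
  by rewrite rhom0 rhom_id addr0.
have p2cm j : push p2 cm j = m j.
  apply/lfunP => u; rewrite comp_lfunE add_lfunE !comp_lfunE rhomDr -!rhom_comp h2 h4.
  by rewrite rhom0 rhom_id add0r.
have [G [i [g [ii ig gg GB]]]] := generated_subrep cm.
have rg : relation g := relation_sub ii ig (relation_sum i1 i2 rc rm).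
have cE j : c j = push (p1 ** i) g j.
  by rewrite -p1cm /push ig /push comp_lfunA.
have psurj : pw_surj (p1 ** i).
  have [I [e [io [es ioi ioe]]]] := image_exists (p1 ** i).
  have ios : pw_surj io.
    apply: (gc I io (push e g) ioi) => j; rewrite cE -ioe /push.
    by rewrite comp_lfunA.
  move=> z u; have [w <-] := ios z u; have [v <-] := es z w.
  by exists v; rewrite -ioe rhom_comp.
have GC : (total_dim s G <= total_dim s C)%N.
  by rewrite Cn; apply: maxn; apply/asboolP; exists G, g.
(* Maximality: a surjection onto C from G, which is no larger than C. *)
have pinj : pw_inj (p1 ** i).
  move=> z u pu; case: (boolP ((z : vtx) \in s)) => [zs | zs]; last exact: (supp _ GB z zs).
  have dGC : (\dim {: G z} <= \dim {: C z})%N.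
    move: GC; rewrite /total_dim !(big_rem _ zs) /= => le.
    have le' : (\sum_(y <- rem (z : vtx) s) \dim {: C y} <=
                \sum_(y <- rem (z : vtx) s) \dim {: G y})%N.
      by apply: leq_sum => y _; apply: pw_surj_dim psurj.
    rewrite -(leq_add2r (\sum_(y <- rem (z : vtx) s) \dim {: C y})) (leq_trans _ le) //.
    by rewrite leq_add2l.
  have := limg_ker_dim (rhom (p1 ** i) z) fullv.
  rewrite (pw_surj_limg z psurj) capfv => dE.
  have : \dim (lker (rhom (p1 ** i) z)) = 0%N.
    by apply/eqP; rewrite -leqn0 -(leq_add2r (\dim {: C z})) dE add0n.
  move/eqP; rewrite dimv_eq0 => /eqP k0.
  by apply/eqP; rewrite -memv0 -k0 memv_ker pu.
have [th [thp pth]] := pw_iso pinj psurj.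
exists (p2 ** i ** th) => j.
rewrite -p2cm; apply/lfunP => u.
rewrite [LHS]comp_lfunE ig [RHS]comp_lfunE cE !comp_lfunE.
rewrite -!rhom_comp; congr (rhom _ _ _).
by rewrite -!compmA thp compm1.
Qed.

End Generated.

(** * Factorization as a system of linear equations *)

Section LiftingSystem.
Variables (k : fieldType) (Q : quiver).
Notation Rep := (representation k Q).
Notation vtx := {classic Q}.
Implicit Types L M N P : Rep.
Variables (X Y : Rep) (f : X ~> Y).

(** The target comes first, since the arrows ending in a finite set of vertices
    are listed target by target. *)
Definition arrow_to := {y : Q & {w : Q & arrow w y}}.

Variables (sX sY : nat) (vY : 'I_sY -> Q) (aX : 'I_sX -> arrow_to).

Definition lift_index : finType := ('I_sY + 'I_sX)%type.

Definition lift_src (j : lift_index) : Q :=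
  match j with inl i => vY i | inr i => projT1 (projT2 (aX i)) end.

Definition lift_val (j : lift_index) : vectType k :=
  match j with inl i => Y (vY i) | inr i => X (projT1 (aX i)) end.

(** The equations that make vertexwise maps h a morphism with f h = f'; the
    right-hand sides follow. *)
Definition lift_eq M (h : forall x, 'Hom(M x, X x)) (j : lift_index) :
    'Hom(M (lift_src j), lift_val j) :=
  match j return 'Hom(M (lift_src j), lift_val j) with
  | inl i => (rhom f (vY i) \o h (vY i))%VF
  | inr i => (rmap X (projT2 (projT2 (aX i))) \o h (projT1 (projT2 (aX i))))%VF -
             (h (projT1 (aX i)) \o rmap M (projT2 (projT2 (aX i))))%VF
  end.

Definition lift_rhs M (f' : M ~> Y) (j : lift_index) : 'Hom(M (lift_src j), lift_val j) :=
  match j return 'Hom(M (lift_src j), lift_val j) with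
  | inl i => rhom f' (vY i)
  | inr i => 0
  end.

Lemma lift_eq_nat M N (i : M ~> N) (h : forall x, 'Hom(N x, X x)) j :
  lift_eq (fun x => (h x \o rhom i x)%VF) j = (lift_eq h j \o rhom i (lift_src j))%VF.
Proof.
case: j => j; apply/lfunP => u; rewrite /= !comp_lfunE //.
by rewrite !add_lfunE !opp_lfunE !comp_lfunE rhom_nat.
Qed.

Lemma lift_eq_linear M c (h h' : forall x, 'Hom(M x, X x)) j :
  lift_eq (fun x => c *: h x + h' x) j = c *: lift_eq h j + lift_eq h' j.
Proof.
case: j => j; apply/lfunP => u; rewrite /= !add_lfunE !scale_lfunE !comp_lfunE.
  by rewrite add_lfunE scale_lfunE linearP.
rewrite !add_lfunE !opp_lfunE !comp_lfunE !add_lfunE !scale_lfunE linearP.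
by rewrite scalerBr opprD addrACA.
Qed.

Lemma lift_rhs_comp M N (g : M ~> N) (f' : N ~> Y) j :
  lift_rhs (f' ** g) j = (lift_rhs f' j \o rhom g (lift_src j))%VF.
Proof. by case: j => j //=; rewrite comp_lfun0l. Qed.

Lemma lift_eq_factor M (h : M ~> X) j : lift_eq (rhom h) j = lift_rhs (f ** h) j.
Proof.
case: j => j //=; apply/lfunP => u.
by rewrite add_lfunE opp_lfunE !comp_lfunE zero_lfunE rhom_nat subrr.
Qed.

Hypothesis vYP : forall y : Q, (forall i, vY i <> y) -> forall u : Y y, u = 0.
Hypothesis aXP : forall (w y : Q) (a : arrow w y),
  (forall i, aX i <> existT _ y (existT _ w a)) -> forall u : X y, u = 0.

Lemma lift_system_solution M (f' : M ~> Y) (h : forall x, 'Hom(M x, X x)) :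
  (forall j, lift_eq h j = lift_rhs f' j) -> exists h' : M ~> X, f ** h' = f'.
Proof.
move=> hE.
have hP x y (b : arrow x y) : (h y \o rmap M b)%VF = (rmap X b \o h x)%VF.
  apply/lfunP => u.
  case: (pselect (exists i, aX i = existT _ y (existT _ x b))) => [[i iE]|ni].
    have := hE (inr i); rewrite /= iE /= => /eqP.
    by rewrite subr_eq0 => /eqP ->.
  have X0 := aXP (fun i e => ni (ex_intro _ i e)).
  by rewrite [LHS]X0 [RHS]X0.
exists (@RepHom k Q M X h hP); apply/rhom_eqP => y u; rewrite rhom_comp /=.
case: (pselect (exists i, vY i = y)) => [[i iE]|ni].
  by subst y; have := hE (inl i) => /= /lfunP/(_ u); rewrite comp_lfunE.
have Y0 := vYP (fun i e => ni (ex_intro _ i e)).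
by rewrite [LHS]Y0 [RHS]Y0.
Qed.

End LiftingSystem.

Section NoRightInfinitePath.
Variables (k : fieldType) (Q : quiver).
Notation Rep := (representation k Q).
Notation vtx := {classic Q}.
Implicit Types L M N P : Rep.
Hypothesis Qslf : strongly_locally_finite Q.
Let Qi : interval_finite Q := proj2 Qslf.
Hypothesis noray : ~ has_right_infinite_path Q.

Lemma arrows_into (s : seq vtx) : exists l : seq {classic arrow_to Q},
  forall (w y : Q) (a : arrow w y), (y : vtx) \in s ->
    (existT _ y (existT _ w a) : {classic arrow_to Q}) \in l.
Proof.
pose l (y : vtx) := sval (cid (in_arrows Qslf y)).
have lP (y : vtx) (w : Q) (a : arrow w y) : (existT _ w a : {classic _}) \in l y.
  exact: (svalP (cid (in_arrows Qslf y))).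
pose to (y : vtx) (t : {classic {w : Q & arrow w y}}) : {classic arrow_to Q} :=
  existT (fun y => {w : Q & arrow w y}) y t.
pose tos (y : vtx) : seq {classic arrow_to Q} := [seq to y t | t <- l y].
exists (flatten [seq tos y | y <- s]) => w y a ys.
apply/flatten_mapP; exists (y : vtx) => //.
by apply/mapP; exists (existT _ w a : {classic {w : Q & arrow w y}}); first exact: lP.
Qed.

(** If f' does not factor, then by linear duality it violates a relation in M,
    which is the image of the universal relation under some g : C -> M. So
    f' g violates the universal relation, and does not factor either. *)
Lemma determined_by_object (X Y : Rep) (f : X ~> Y) :
  fin_dim X -> fin_dim Y -> exists C : Rep, fin_dim C /\
    forall M (f' : M ~> Y), ~ (exists h, f ** h = f') ->
      exists g : C ~> M, ~ exists h, f ** h = f' ** g.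
Proof.
move=> [sX sXP] [sY sYP].
have [l lP] := arrows_into sX.
pose vY := tnth (in_tuple sY) : 'I_(size sY) -> Q.
pose aX := tnth (in_tuple l) : 'I_(size l) -> arrow_to Q.
have vYP : forall y : Q, (forall i, vY i <> y) -> forall u : Y y, u = 0.
  move=> y ny; apply: sYP; apply/negP => /(tnthP (in_tuple sY))[i yE].
  by case: (ny i); rewrite yE.
have aXP : forall (w y : Q) (a : arrow w y),
  (forall i, aX i <> existT _ y (existT _ w a)) -> forall u : X y, u = 0.
  move=> w y a na; apply: sXP; apply/negP => /(lP w y a)/(tnthP (in_tuple l))[i aE].
  by case: (na i); rewrite aE.
pose E M := @lift_eq k Q X Y f _ _ vY aX M.
have [C [c [fC rc univ]]] := @universal_relation k Q Qi _ _ _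
  (reachable_finite Qslf noray) X E (fun M N => @lift_eq_nat k Q X Y f _ _ vY aX M N).
exists C; split=> // M f' nf.
have [|||m [mrel mw]] := @linear_duality k (lift_index (size l) (size sY))
  (fun j => M (lift_src vY aX j)) (lift_val X Y vY aX)
  (fun e => exists h, forall j, E M h j = e j) (lift_rhs X vY aX f').
- exists (fun x => 0) => j; apply/lfunP => u.
  by case: j u => j u; rewrite /= ?add_lfunE ?opp_lfunE !comp_lfunE !zero_lfunE !linear0 ?oppr0 ?addr0.
- move=> a e e' [h hE] [h' hE']; exists (fun x => a *: h x + h' x) => j.
  by rewrite /E lift_eq_linear -/(E M) hE hE'.
- move=> e ew [h hE]; apply: nf; apply: (lift_system_solution vYP aXP (h := h)) => j.
  by rewrite -/(E M h j) hE ew.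
have [|g gE] := univ M m.
  by move=> h; apply: mrel; exists h.
exists g => -[h fh]; apply: mw.
rewrite -[RHS](rc (rhom h)); apply: eq_bigr => j _.
by rewrite /E lift_eq_factor fh lift_rhs_comp gE comp_lfunA.
Qed.

End NoRightInfinitePath.

(** * Almost split sequences and minimal determiners *)

Section AuslanderReiten.
Variables (k : fieldType) (Q : quiver).
Notation Rep := (representation k Q).
Implicit Types L M N P : Rep.
Hypothesis Qslf : strongly_locally_finite Q.
Let Qi : interval_finite Q := proj2 Qslf.
Hypothesis noray : ~ has_right_infinite_path Q.
Notation Rep_plus := (rep_plus k Q).

Definition fd_ob M (H : fin_dim M) : Rep_plus := exist _ M (fin_dim_fp Qslf noray H).

Lemma ob_fin_dim (X : Rep_plus) : fin_dim (sval X : rep k Q).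
Proof. exact: fp_fin_dim Qslf noray _ (svalP X). Qed.

Lemma rep_scale_comp L M N (c : k) (g : M ~> N) (f : L ~> M) :
  g ** rep_scale c f = rep_scale c (g ** f).
Proof. by apply/rhom_eqP => x u; rewrite rhomE !rep_scaleE rhomE rhomZ. Qed.

Lemma rep_scaleD M N (c : k) (f g : M ~> N) :
  rep_scale c (f + g) = rep_scale c f + rep_scale c g.
Proof. by apply/rhom_eqP => x u; rewrite rhomD !rep_scaleE rhomD scalerDr. Qed.

(** Let C determine f. Among the g from indecomposable summands Z of C to X' such
    that f' g does not factor, choose one for which f' g Hom(C, Z) + f Hom(C, X)
    has least dimension. If f' g r does not factor, minimality yields an
    endomorphism phi of Z, passing through r, such that f' g (1 - phi)
    factors. So 1 - phi is not invertible; hence phi is, and r splits. *)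
Lemma rep_plus_has_almost_factoring (X Y : Rep_plus) (f : mor X Y) : has_almost_factoring f.
Proof.
have [C0 [fC0 det]] := determined_by_object Qslf noray (f : sval X ~> sval Y)
  (ob_fin_dim X) (ob_fin_dim Y).
pose C : Rep_plus := fd_ob fC0.
have {}det (M : Rep_plus) (f' : mor M Y) : ~ factors_through f' f ->
    exists g : mor C M, ~ factors_through (f' ** g) f.
  by move=> nf; have [g ng] := det (sval M) f' nf; exists g.
move=> X' f' nf'.
have [s gs] := fp_fin_gen Qi (svalP C).
pose W := hom_space (sval C) (sval Y) s.
pose I (Z : Rep_plus) (g : mor Z X') (w : W) :=
  exists (a : mor C Z) (b : mor C X), w = hom_eval s (f' ** g ** a + f ** b : sval C ~> sval Y).
have IU Z (g : mor Z X') : exists U : {vspace W}, forall w, w \in U <-> I Z g w.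
  apply: pred_vspace => [|c _ _ [a [b ->]] [a' [b' ->]]].
    exists 0, 0; rewrite !compm0 addr0; apply/esym; exact: hom_eval0.
  exists (rep_scale c (a : sval C ~> sval Z) + a'), (rep_scale c (b : sval C ~> sval X) + b').
  rewrite -hom_evalZ -hom_evalD; congr hom_eval.
  rewrite !compDr addrACA; congr (_ + _).
  by rewrite rep_scaleD -!rep_scale_comp.
pose cand (Z : Rep_plus) (i : mor Z C) (p : mor C Z) (g : mor Z X') :=
  [/\ indecomposable Z, p ** i = idm Z & ~ factors_through (f' ** g) f].
pose P n := `[< exists Z i p g (U : {vspace W}),
  [/\ @cand Z i p g, forall w, w \in U <-> I Z g w & \dim U = n] >].
have mkcand (M : Rep_plus) (g : mor M X') : ~ factors_through (f' ** g) f ->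
    exists (h : mor C M) Z i p, @cand Z i p (g ** h ** i).
  move=> nf; have [h nfh] := det M _ nf.
  have [Z [i [p [indZ pi nfi]]]] := indecomposable_retract Qi nfh.
  by exists h, Z, i, p; split=> //; rewrite !compmA.
have exP : exists n, P n.
  have [|h [Z [i [p cnd]]]] := mkcand X' (idm X'); first by rewrite compm1.
  have [U UE] := IU Z (idm X' ** h ** i).
  by exists (\dim U); apply/asboolP; exists Z, i, p, (idm X' ** h ** i), U.
case: (ex_minnP exP) => n /asboolP[Z [i [p [g [U [[indZ pi nfg] UE dU]]]]]] minn.
exists Z, g; split=> //; split=> // V r nsr; apply: contrapT => nfr.
have [|h [Z' [i' [p' cnd]]]] := mkcand V (g ** r); first by rewrite compmA.
have [U' UE'] := IU Z' (g ** r ** h ** i').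
(* The subspace of f' g r is contained in that of f' g, so minimality applies. *)
have UU' : U = U'.
  apply/esym/eqP; rewrite eqEdim; apply/andP; split; last first.
    by rewrite dU; apply: minn; apply/asboolP; exists Z', i', p', (g ** r ** h ** i'), U'.
  apply/subvP => w /UE'[a [b ->]]; apply/UE.
  by exists (r ** h ** i' ** a), b; rewrite !compmA.
have : hom_eval s (f' ** g ** p + f ** 0 : sval C ~> sval Y) \in U by apply/UE; exists p, 0.
rewrite UU' => /UE'[a [b E]].
have {}E : f' ** g ** p = f' ** (g ** r ** h ** i') ** a + f ** b.
  apply/eqP; rewrite -subr_eq0; apply/eqP; apply: (generated_by_hom_eval gs).
  have H : hom_eval s (f' ** g ** p : sval C ~> sval Y) = hom_eval s (f' ** (g ** r ** h ** i') ** a + f ** b : sval C ~> sval Y).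
    by rewrite -E compm0 addr0.
  apply: (addIr (hom_eval s (f' ** (g ** r ** h ** i') ** a + f ** b : sval C ~> sval Y))).
  by rewrite add0r -hom_evalD subrK.
(* The equation E, composed with i, says that f' g (1 - phi) factors. *)
pose phi : mor Z Z := r ** h ** i' ** a ** i.
have E2 : f' ** g ** (idm Z - phi) = f ** (b ** i).
  rewrite compBr compm1 -{1}[f' ** g]compm1 -pi compmA E compDl !compmA.
  by rewrite addrAC subrr add0r.
case: (rep_plus_local Qi indZ phi) => [[z [_ phz]] | [z [_ phz]]].
  by apply: nsr; exists (h ** i' ** a ** i ** z); rewrite !compmA.
apply: nfg; exists (b ** i ** z).
by rewrite compmA -E2 -compmA phz compm1.
Qed.

Lemma rep_plus_short_exact (X Y Z : Rep_plus) (s : mor X Y) (t : mor Y Z) :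
  @pw_inj k Q (sval X) (sval Y) s -> @pw_surj k Q (sval Y) (sval Z) t ->
  @pw_exact k Q _ _ _ t s -> short_exact s t.
Proof.
move=> si ts ex; have [[ts0 ker] [_ coker]] := pw_short_exact si ts ex.
by split; split=> // W u; [apply: ker | apply: coker].
Qed.

Implicit Types A E F X Y Z W : Rep.

Lemma split_mono_split_epi A E Z (s : A ~> E) (t : E ~> Z) :
  pw_surj t -> pw_exact t s -> split_mono s -> split_epi t.
Proof.
move=> ts ex [r rs]; have tsz := pw_exact_comp0 ex.
have [|sg sgt] := desc_cokernel (g := idm (E : rep k Q) - s ** r) ts ex.
  by rewrite compBl -compmA rs comp1m compm1 subrr.
exists sg; apply: (pw_surj_cancel ts); rewrite -compmA sgt.
by rewrite compBr compm1 compmA tsz comp0m subr0 comp1m.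
Qed.

Lemma split_epi_split_mono A E Z (s : A ~> E) (t : E ~> Z) :
  pw_inj s -> pw_exact t s -> split_epi t -> split_mono s.
Proof.
move=> si ex [sg tsg]; have tsz := pw_exact_comp0 ex.
have [|r rE] := lift_kernel (g := idm (E : rep k Q) - sg ** t) si ex.
  by rewrite compBr compm1 compmA tsg comp1m subrr.
exists r; apply: (pw_inj_cancel si); rewrite compmA rE.
by rewrite compBl comp1m -compmA tsz compm0 subr0 compm1.
Qed.

(** Push the sequence out along u. If the result splits, u extends to E. If not,
    it maps back to the original sequence over Z, by some om : W -> A on the
    left. Now [om ** u] or its complement is invertible: the former would make
    u a section, the latter s. *)
Lemma extend_along_almost_split A E Z W (s : A ~> E) (t : E ~> Z) (u : A ~> W) :
    pw_inj s -> pw_surj t -> pw_exact t s -> fin_dim E -> fin_dim W ->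
    local_endo (A : rep k Q) -> ~ split_mono s ->
    (forall F (tau : F ~> Z), fin_dim F -> ~ split_epi tau -> exists h : F ~> E, t ** h = tau) ->
  ~ split_mono u -> exists h : E ~> W, h ** s = u.
Proof.
move=> si ts ex fE fW locA nss ras nsu; have tsz := pw_exact_comp0 ex.
have [S [i1 [i2 [p1 [p2 [h1 h2 h3 h4 ES]]]]]] := direct_sum_exists E W.
pose j : A ~> S := i1 ** s - i2 ** u.
have p1j : p1 ** j = s by rewrite compBr !compmA h1 h3 comp1m comp0m subr0.
have [F [q [qs qex]]] := cokernel_exists j.
have qj : q ** j = 0 := pw_exact_comp0 qex.
have qi : q ** i1 ** s = q ** i2 ** u.
  by apply/eqP; rewrite -subr_eq0 -!compmA -compBr qj.
have fF : fin_dim (F : rep k Q).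
  apply: (fin_dim_surj qs); apply: (@fin_dim_sum k Q E W) => //.
  by exists i1, i2, p1, p2.
have [tau tauq] : exists tau : F ~> Z, tau ** q = t ** p1.
  by apply: (desc_cokernel qs qex); rewrite -compmA p1j.
have tauqi2 : tau ** (q ** i2) = 0 by rewrite compmA tauq -compmA h3 compm0.
have tauqi1 : tau ** (q ** i1) = t by rewrite compmA tauq -compmA h1 compm1.
have qi2i : pw_inj (q ** i2).
  move=> x w; rewrite rhom_comp => /qex[a ja].
  have a0 : a = 0.
    by apply: si; rewrite -p1j rhom_comp ja -rhom_comp h3 rhom0.
  have := congr1 (rhom p2 x) ja; rewrite a0 !linear0 -rhom_comp h2 rhom_id.
  by move=> <-.
have qi2ex : pw_exact tau (q ** i2).
  move=> x v; split=> [|[w <-]]; last by rewrite -rhom_comp tauqi2 rhom0.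
  have [w <-] := qs x v; rewrite -rhom_comp tauq rhom_comp => /ex[a ja].
  exists (rhom u x a + rhom p2 x w).
  rewrite rhomDr -[rhom (q ** i2) x (rhom u x a)]rhom_comp -qi !rhom_comp ja -rhomDr.
  by congr (rhom q x _); have /rhom_eqP/(_ x w) := ES; rewrite rhomD !rhom_comp rhom_id.
case: (pselect (split_epi tau)) => [st | nst].
  have [r rqi2] := split_epi_split_mono qi2i qi2ex st.
  exists (r ** (q ** i1)).
  by rewrite -compmA qi compmA rqi2 comp1m.
have [th tth] := ras F tau fF nst.
have [|om omE] := lift_kernel (g := th ** (q ** i2)) si ex.
  by rewrite compmA tth.
have ths : th ** (q ** i1) ** s = s ** (om ** u).
  by rewrite -compmA qi compmA -omE compmA.
have tth1 : t ** (th ** (q ** i1)) = t by rewrite compmA tth.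
case: (locA (om ** u)) => [/local_endo_section // | iso].
have [|rho rhoE] := lift_kernel (g := idm (E : rep k Q) - th ** (q ** i1)) si ex.
  by rewrite compBr compm1 tth1 subrr.
case: nss; apply: (@local_endo_section _ _ _ s rho).
suff -> : rho ** s = idm (A : rep k Q) - om ** u by [].
apply: (pw_inj_cancel si); rewrite compmA rhoE.
by rewrite compBl comp1m compBr compm1 ths.
Qed.

(** A lift of r to the pullback E of f and g is a factorization of [g ** r]
    through f. *)
Lemma pullback_almost_split A X Y Z (s0 : A ~> X) (f : X ~> Y) (g : Z ~> Y) :
    pw_inj s0 -> pw_surj f -> pw_exact f s0 -> fin_dim X -> fin_dim Z ->
    ~ (exists h, f ** h = g) ->
    (forall W (r : W ~> Z), fin_dim W -> ~ split_epi r -> exists h, f ** h = g ** r) ->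
  exists E (s : A ~> E) (t : E ~> Z), [/\ fin_dim E,
    [/\ pw_inj s, pw_surj t & pw_exact t s], ~ split_epi t &
    forall W (r : W ~> Z), fin_dim W -> ~ split_epi r -> exists h : W ~> E, t ** h = r].
Proof.
move=> s0i fs fex fX fZ nfg alg; have fs0 := pw_exact_comp0 fex.
have [S [i1 [i2 [p1 [p2 [h1 h2 h3 h4 ES]]]]]] := direct_sum_exists X Z.
have [E [e [ei eex]]] := kernel_exists (f ** p1 - g ** p2).
have fE : fin_dim (E : rep k Q).
  apply: (fin_dim_inj ei); apply: (@fin_dim_sum k Q X Z) => //.
  by exists i1, i2, p1, p2.
have lift (W : Rep) (h : W ~> X) (r : W ~> Z) : f ** h = g ** r ->
    exists v : W ~> E, p1 ** e ** v = h /\ p2 ** e ** v = r.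
  move=> fhgr; have [|v ev] := lift_kernel (g := i1 ** h + i2 ** r) ei eex.
    rewrite compBl !compDr -!compmA !(compmA p1) !(compmA p2) h1 h2 h3 h4.
    by rewrite !comp0m !comp1m !compm0 addr0 add0r fhgr subrr.
  exists v; rewrite -!compmA ev !compDr !compmA h1 h2 h3 h4.
  by rewrite !comp0m !comp1m addr0 add0r.
have [s [p1s p2s]] : exists s, p1 ** e ** s = s0 /\ p2 ** e ** s = 0.
  by apply: lift; rewrite compm0.
pose t : E ~> Z := p2 ** e.
have fgt : f ** (p1 ** e) = g ** t.
  have := pw_exact_comp0 eex; rewrite compBl -!compmA => /eqP.
  by rewrite subr_eq0 => /eqP.
have dec x u : rhom e x u = rhom i1 x (rhom (p1 ** e) x u) + rhom i2 x (rhom t x u).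
  have /rhom_eqP/(_ x (rhom e x u)) := ES.
  by rewrite rhomD !rhom_comp rhom_id.
exists E, s, t; split=> //.
- split.
  + by move=> x u su; apply: s0i; rewrite -p1s rhom_comp su linear0.
  + move=> x z; have [w fw] := fs x (rhom g x z).
    have p1E : rhom p1 x (rhom i1 x w + rhom i2 x z) = w.
      by rewrite rhomDr -!rhom_comp h1 h3 rhom0 rhom_id addr0.
    have p2E : rhom p2 x (rhom i1 x w + rhom i2 x z) = z.
      by rewrite rhomDr -!rhom_comp h2 h4 rhom0 rhom_id add0r.
    have /eex[v ev] : rhom (f ** p1 - g ** p2) x (rhom i1 x w + rhom i2 x z) = 0.
      by rewrite rhomB !rhom_comp p1E p2E fw subrr.
    by exists v; rewrite rhom_comp ev.
  + move=> x w; split=> [tw0 | [v <-]]; last by rewrite -rhom_comp p2s rhom0.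
    have /fex[v s0v] : rhom f x (rhom (p1 ** e) x w) = 0.
      by rewrite -rhom_comp fgt rhom_comp tw0 linear0.
    exists v; apply: (pw_injP ei).
    have tsv : rhom t x (rhom s x v) = 0 by rewrite -rhom_comp p2s rhom0.
    by rewrite [LHS]dec [RHS]dec tw0 tsv -s0v -p1s [in RHS]rhom_comp.
- move=> [sg tsg]; apply: nfg; exists (p1 ** e ** sg).
  by rewrite compmA fgt -compmA tsg compm1.
- move=> W r fW nsr; have [h fh] := alg W r fW nsr; have [v [_ tv]] := lift W h r fh.
  by exists v.
Qed.

Lemma almost_split_sequence_exists (A X : Rep_plus) (s0 : mor A X) :
  indecomposable A -> @pw_inj k Q (sval A) (sval X) s0 -> ~ split_mono s0 ->
  exists (B Z : Rep_plus) (s : mor A B) (t : mor B Z), almost_split_sequence s t.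
Proof.
move=> indA s0i ns0.
have [Y0 [f [fs fex]]] := cokernel_exists (s0 : sval A ~> sval X).
pose Y : Rep_plus := fd_ob (fin_dim_surj fs (ob_fin_dim X)).
have nsf : ~ factors_through (idm Y) (f : mor X Y).
  by move=> [sg fsg]; apply: ns0; apply: (split_epi_split_mono s0i fex); exists sg.
have [Z [g0 [indZ ag0]]] := rep_plus_has_almost_factoring nsf.
rewrite comp1m in ag0; have [nfg alg] := ag0.
have alg' W (r : W ~> sval Z) : fin_dim W -> ~ split_epi r ->
    exists h : W ~> sval X, f ** h = (g0 : sval Z ~> Y0) ** r.
  by move=> fW nsr; have [h fh] := alg (fd_ob fW) r nsr; exists h.
have [E [s [t [fE [si ts ex] nst ras]]]] := pullback_almost_split s0i fs fex
  (ob_fin_dim X) (ob_fin_dim Z) nfg alg'.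
exists (fd_ob fE), Z, s, t; split.
- exact: rep_plus_short_exact.
- split=> [sms | W u nsu]; first exact: nst (split_mono_split_epi ts ex sms).
  have [h hs] := @extend_along_almost_split _ _ _ (sval W) s t u si ts ex fE (ob_fin_dim W)
    (rep_plus_local Qi indA) (fun sms => nst (split_mono_split_epi ts ex sms)) ras nsu.
  by exists h.
- split=> // W r nsr; have [h th] := ras (sval W) r (ob_fin_dim W) nsr.
  by exists h.
Qed.

(** If f did not kill m, then the pushout of the simple subobject spanned by m,
    included in A and mapped to Z by f, would contain A as a summand. This
    gives an endomorphism of A through f which fixes m, so that its complement
    is not invertible; then it is invertible and f is a section. *)
Lemma non_section_kills_socle A Z (f : A ~> Z) x (m : (A : Rep) x) :
    socle_elt m -> fin_dim A -> fin_dim Z -> local_endo (A : rep k Q) ->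
    (forall F (s : A ~> F), fin_dim F -> pw_inj s -> split_mono s) ->
  ~ split_mono f -> f ** yoneda Qi m = 0.
Proof.
move=> soc fA fZ locA inj nsf; have [mn0 mk] := soc.
pose y := yoneda Qi m; rewrite -/y.
have ym : rhom y x (pgen k Qi x) = m by apply: yoneda_gen.
have y0 : y <> 0 by move=> y0; apply: mn0; rewrite -ym y0 rhom0.
have fyE : f ** y = yoneda Qi (rhom f x m).
  by apply: (projective_hom_eq (Qi := Qi)); rewrite rhom_comp ym yoneda_gen.
rewrite fyE; case: (pselect (rhom f x m = 0)) => [fm0|fmn0].
  by apply: (projective_hom_eq (Qi := Qi)); rewrite yoneda_gen rhom0.
exfalso.
have socf : socle_elt (rhom f x m).
  by split=> // z a; rewrite -rhom_nat mk linear0.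
have [S [i1 [i2 [p1 [p2 [h1 h2 h3 h4 ES]]]]]] := direct_sum_exists A Z.
pose j := i1 ** y - i2 ** (f ** y).
have [F [q [qs qex]]] := cokernel_exists j.
have qj : q ** j = 0 := pw_exact_comp0 qex.
have qi : q ** i1 ** y = q ** i2 ** (f ** y).
  by apply/eqP; rewrite -subr_eq0 -!compmA -compBr qj.
have p1j : p1 ** j = y by rewrite compBr !compmA h1 h3 comp1m !comp0m subr0.
have p2j : p2 ** j = - (f ** y) by rewrite compBr !compmA h2 h4 comp1m !comp0m sub0r.
have qi1 : pw_inj (q ** i1).
  move=> z a; rewrite rhom_comp => /qex[w jw].
  have aE : rhom y z w = a by rewrite -p1j rhom_comp jw -rhom_comp h1 rhom_id.
  have : rhom (f ** y) z w = 0.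
    apply: oppr_inj; rewrite oppr0 -rhomN -p2j rhom_comp jw -rhom_comp h4.
    by rewrite rhom0.
  rewrite fyE => /(yoneda_socle Qslf _ socf)/(yoneda_socle Qslf _ soc).
  by rewrite -aE.
have fF : fin_dim (F : rep k Q).
  apply: (fin_dim_surj qs); apply: (@fin_dim_sum k Q A Z) => //.
  by exists i1, i2, p1, p2.
have [r rqi1] := inj F (q ** i1) fF qi1.
case: (locA (r ** (q ** i2) ** f)) => [/local_endo_section // | [z [zl _]]].
apply: y0; rewrite -[LHS]comp1m -zl -compmA.
have -> : (idm (A : rep k Q) - r ** (q ** i2) ** f) ** y = 0; last by rewrite compm0.
rewrite compBl comp1m -!compmA (compmA q i2) -qi -!compmA.
by rewrite (compmA q i1) (compmA r) rqi1 comp1m subrr.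
Qed.

Lemma quotient_by_socle_almost_split (A : Rep_plus) :
  indecomposable A ->
  (forall (X : Rep_plus) (s : mor A X), @pw_inj k Q (sval A) (sval X) s -> split_mono s) ->
  exists (B : Rep_plus) (g : mor A B), minimal_left_almost_split g /\ epi g.
Proof.
move=> indA inj; have locA := rep_plus_local Qi indA.
have [x0 [m0 m0n]] : exists x0 (m0 : (sval A : Rep) x0), m0 <> 0.
  apply: contrapT => H; case: indA => nz _; apply: nz.
  apply: (@rhom_eqP k Q (sval A) (sval A) _ _).1 => x u; rewrite rhom_id [RHS]zero_lfunE.
  by apply: contrapT => u0; apply: H; exists x, u.
have [x [m soc]] := socle_elt_exists noray m0n.
have [mn0 mk] := soc.
pose y := yoneda Qi m.
have [B0 [g [gs gex]]] := cokernel_exists y.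
have gy : g ** y = 0 := pw_exact_comp0 gex.
have gm : rhom g x m = 0 by apply/gex; exists (pgen k Qi x); apply: yoneda_gen.
pose B : Rep_plus := fd_ob (fin_dim_surj gs (ob_fin_dim A)).
have nsg : ~ split_mono (g : mor A B).
  by move=> sg; apply/mn0/(@split_mono_pw_inj k Q (sval A) B0 g sg).
exists B, g; split; last by move=> Z u v uv; apply: (pw_surj_cancel gs).
split.
  move=> h hg; have -> : h = idm B.
    by apply: (pw_surj_cancel gs); rewrite [RHS](@comp1m (rep k Q)).
  by exists (idm B); rewrite !comp1m.
split=> // Z f nsf.
have inj' F (s : sval A ~> F) : fin_dim F -> pw_inj s -> split_mono s.
  by move=> fF si; have [r rs] := inj (fd_ob fF) s si; exists r.
have fy : (f : sval A ~> sval Z) ** y = 0.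
  exact: (non_section_kills_socle soc (ob_fin_dim A) (ob_fin_dim Z) locA inj' nsf).
by have [h hg] := desc_cokernel gs gex fy; exists h.
Qed.

Lemma left_Auslander_Reiten_rep_plus : left_Auslander_Reiten Rep_plus.
Proof.
move=> A indA.
case: (pselect (forall (X : Rep_plus) (s : mor A X),
    @pw_inj k Q (sval A) (sval X) s -> split_mono s)) => [inj|].
  by left; apply: quotient_by_socle_almost_split.
move=> /existsNP[X /existsNP[s /not_implyP[si ns]]].
by right; apply: almost_split_sequence_exists si ns.
Qed.

End AuslanderReiten.

Theorem theoremD (k : fieldType) (Q : quiver)
    (Q_slf : strongly_locally_finite Q) :
  (~ has_right_infinite_path Q <-> left_Auslander_Reiten (rep_plus k Q)) /\
  (left_Auslander_Reiten (rep_plus k Q) <->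
     forall (X Y : rep_plus k Q) (f : mor X Y),
       has_unique_minimal_right_determiner f).
Proof.
have Qi := proj2 Q_slf.
have AR_noray : left_Auslander_Reiten (rep_plus k Q) -> ~ has_right_infinite_path Q.
  by move=> AR [v [a]]; apply: (infinite_path_not_left_AR Qi a AR).
split; split=> //.
- exact: left_Auslander_Reiten_rep_plus.
- move=> /AR_noray noray X Y f; apply: unique_minimal_right_determiner.
    exact: rep_plus_idempotents_split.
  exact: rep_plus_has_almost_factoring.
- move=> det; apply: left_Auslander_Reiten_rep_plus => // -[v [a]].
  have [X [Y [f []]]] := infinite_path_no_minimal_determiner k Qi a.
  by have [D [Dmin _]] := det X Y f; exists D.
Qed.
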